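(* Let $J,I\subseteq\mathbb{R}$ be open intervals containing $0$ and let $\gamma\colon J\times I\to\mathrm{AdS}$ be a solution of the LIEN flow with bending $\kappa(s,t)$. Consider two $\mathcal{T}$-transforms of $\gamma$, namely $\gamma_1=\mathcal{T}_{\xi_1,f_1}(\gamma)$ and $\gamma_2=\mathcal{T}_{\xi_2,f_2}(\gamma)$, with parameters $\xi_1\neq\xi_2$ (nonzero real constants) and transforming functions $f_1,f_2\colon J\times I\to\mathbb{R}$ (so $f_i$ is a solution of the Wahlquist--Estabrook equation for $\kappa$ and $\cosh(2\xi_i)$) with $f_1\neq f_2$ at every point of $J\times I$. Let $\kappa_1,\kappa_2$ be the bendings of $\gamma_1,\gamma_2$, and put $$f_{2\to1}=-f_1+\frac{\cosh(2\xi_1)-\cosh(2\xi_2)}{f_1-f_2},\qquad f_{1\to2}=-f_2+\frac{\cosh(2\xi_1)-\cosh(2\xi_2)}{f_1-f_2}.$$ Then $f_{2\to1}$ satisfies the Wahlquist--Estabrook equation for $\kappa_1$ and $\lambda_2=\cosh(2\xi_2)$, while $f_{1\to2}$ satisfies the Wahlquist--Estabrook equation for $\kappa_2$ and $\lambda_1=\cosh(2\xi_1)$. Moreover, $$\mathcal{T}_{\xi_2,f_{2\to1}}\bigl(\mathcal{T}_{\xi_1,f_1}(\gamma)\bigr)=\mathcal{T}_{\xi_1,f_{1\to2}}\bigl(\mathcal{T}_{\xi_2,f_2}(\gamma)\bigr),$$ and the bending of $\mathcal{T}_{\xi_2,f_{2\to1}}(\mathcal{T}_{\xi_1,f_1}(\gamma))$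 is the function $$\kappa_{2\to1}=\kappa_{1\to2}=\kappa-2\bigl(\cosh(2\xi_1)-\cosh(2\xi_2)\bigr)\frac{f_1+f_2}{f_1-f_2}+2\left(\frac{\cosh(2\xi_1)-\cosh(2\xi_2)}{f_1-f_2}\right)^2,$$ where $\kappa_{1\to2}$ denotes the bending of $\mathcal{T}_{\xi_1,f_{1\to2}}(\mathcal{T}_{\xi_2,f_2}(\gamma))$. In particular, $\kappa_{2\to1}$ is a solution of the KdV equation $\partial_t\kappa_{2\to1}+\partial_s^3\kappa_{2\to1}-6\kappa_{2\to1}\,\partial_s\kappa_{2\to1}=0$.
   Context: Anti-de Sitter space. On the space $\mathbb{R}^{2,2}$ of real $2\times2$ matrices let $\langle\cdot,\cdot\rangle$ be the inner product of the quadratic form $X\mapsto-\det X$. $\mathrm{AdS}$ denotes $\mathrm{SL}(2,\mathbb{R})\subset\mathbb{R}^{2,2}$ with the induced Lorentzian metric. On $\Lambda^2(\mathbb{R}^{2,2})$ set $\langle\langle U\wedge V,W\wedge Z\rangle\rangle=\langle U,W\rangle\langle V,Z\rangle-\langle U,Z\rangle\langle V,W\rangle$. A null tangent vector $T\in T_X\mathrm{AdS}$ is future-directed if $\langle\langle I_2\wedge \mathsf{J},X\wedge T\rangle\rangle>0$, where $I_2$ is the identity matrix and $\mathsf{J}=\begin{pmatrix}0&1\\-1&0\end{pmatrix}$. Null curves. ''Null curve'' means a smooth immersed curve $\gamma\colon J\to\mathrm{AdS}$ ($J$ an open interval, prime $=d/ds$) with $\langle\gamma',\gamma'\rangle=0$,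 future-directed velocity, no inflection points ($\gamma'\wedge\gamma''\neq0$ everywhere), parameterized by proper time ($\langle\gamma'',\gamma''\rangle=4$). Its bending is $\kappa=-\frac1{16}\langle\gamma''',\gamma'''\rangle$. Spinor frame field. The spinor frame field along a null curve $\gamma$ with bending $\kappa$ is the smooth map $(F_+,F_-)\colon J\to\mathrm{SL}(2,\mathbb{R})\times\mathrm{SL}(2,\mathbb{R})$, defined up to a (common) sign, such that $\gamma=F_+F_-^{-1}$ and $$F_+'=F_+\begin{pmatrix}0&\kappa+1\\1&0\end{pmatrix},\qquad F_-'=F_-\begin{pmatrix}0&\kappa-1\\1&0\end{pmatrix}.$$ All null curves are understood to come with such a spinor frame field. LIEN flow. A solution of the LIEN flow is a smooth map $\gamma\colon J\times I\to\mathrm{AdS}$, $(s,t)\mapsto\gamma(s,t)=\gamma_t(s)$, such that for each $t\in I$ the curve $\gamma_t$ is a null curve (that is, a smooth immersed curve with $\langle\partial_s\gamma,\partial_s\gamma\rangle=0$, future-directed velocity $\partial_s\gamma$, no inflection points, i.e. $\partial_s\gamma\wedge\partial_s^2\gamma\neq0$ everywhere, and $\langle\partial_s^2\gamma,\partial_s^2\gamma\rangle=4$, so that $s$ is proper time), with $\partial_t\gamma=2\partial_s^3\gamma-6\kappa\,\partial_s\gamma$, where $\kappa(s,t)$ is the bending of $\gamma_t$ at $s$. The spinor frame field along $\gamma(s,t)$ is the smooth map $(F_+,F_-)\colon J\times I\to\mathrm{SL}(2,\mathbb{R})\times\mathrm{SL}(2,\mathbb{R})$ whose restriction to each fixed $t$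 is the spinor frame field along $\gamma_t$. The bending of a solution of the LIEN flow satisfies the KdV equation $\partial_t\kappa+\partial_s^3\kappa-6\kappa\,\partial_s\kappa=0$. Wahlquist--Estabrook equation. For a function $\kappa\colon J\times I\to\mathbb{R}$ and a constant $\lambda$, the Wahlquist--Estabrook equation for $\kappa$ and $\lambda$ is the system for $f\colon J\times I\to\mathbb{R}$ $$df=\bigl(\kappa-f^2+\lambda\bigr)ds+\bigl(4\lambda[f^2-\lambda]-2\kappa[f^2+\lambda]+2\kappa^2+2f\,\partial_s\kappa-\partial_s^2\kappa\bigr)dt.$$ $\mathcal{T}$-transform of a solution of the LIEN flow. Let $\gamma$ be a solution of the LIEN flow with bending $\kappa$ and spinor frame field $(F_+,F_-)$, let $\xi\neq0$ be a real constant, and let $f\colon J\times I\to\mathbb{R}$ be a solution of the Wahlquist--Estabrook equation for $\kappa$ and $\lambda=\cosh(2\xi)$. The $\mathcal{T}$-transform of $\gamma$ with parameter $\xi$ and transforming function $f$ is the solution of the LIEN flow $$\mathcal{T}_{\xi,f}(\gamma)=\pm F_+\begin{pmatrix}\tanh(\xi)&-\operatorname{csch}(\xi)\operatorname{sech}(\xi)\,f\\0&\coth(\xi)\end{pmatrix}F_-^{-1},$$ where the sign $\pm$ is fixed once and for all, the same in every transform. *)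

(* Defs.v *)
From Stdlib Require Import Reals.
From Coquelicot Require Import Coquelicot.
Open Scope R_scope.

(** Maps defined on an open interval [J], or on a product [J x K], are
    represented by total functions; every condition is imposed only at points
    of [J], resp. [J x K]. *)

Definition is_open_interval (J : R -> Prop) : Prop :=
  exists a b : Rbar, Rbar_lt a b /\
    forall x : R, J x <-> Rbar_lt a x /\ Rbar_lt x b.

Definition smooth1 (J : R -> Prop) (f : R -> R) : Prop :=
  forall (n : nat) (s : R), J s -> ex_derive_n f n s.

(** [ex_diff_n f n s t]: the partial derivatives of [f] of order at most [n]
    exist and are continuous at [(s, t)]. *)
Definition smooth2 (J K : R -> Prop) (f : R -> R -> R) : Prop :=
  forall (n : nat) (s t : R), J s -> K t -> ex_diff_n f n s t.

Definition coth (x : R) : R := cosh x / sinh x.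
Definition csch (x : R) : R := / sinh x.
Definition sech (x : R) : R := / cosh x.

Definition M2 : Type := @matrix R 2 2.

Definition mat2 (a b c d : R) : M2 := [[a, b], [c, d]].

Definition coef (A : M2) (i j : nat) : R := coeff_mat 0 A i j.

Definition mul (A B : M2) : M2 := Mmult A B.

Definition madd (A B : M2) : M2 := Mplus A B.

Definition mscal (c : R) (A : M2) : M2 :=
  mk_matrix 2 2 (fun i j => c * coef A i j).

Definition mzero : M2 := mat2 0 0 0 0.

Definition I2 : M2 := mat2 1 0 0 1.

Definition J2 : M2 := mat2 0 1 (-1) 0.

Definition det2 (A : M2) : R := coef A 0 0 * coef A 1 1 - coef A 0 1 * coef A 1 0.

Definition inv2 (A : M2) : M2 :=
  mscal (/ det2 A) (mat2 (coef A 1 1) (- coef A 0 1) (- coef A 1 0) (coef A 0 0)).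

(** Polarization of the quadratic form [X |-> - det X]. *)
Definition inner (X Y : M2) : R :=
  (- det2 (madd X Y) - (- det2 X) - (- det2 Y)) / 2.

(** Components, in the basis of matrix units, of the antisymmetric tensor
    U (x) V - V (x) U representing the bivector U /\ V. *)
Definition wedge (U V : M2) (i j k l : nat) : R :=
  coef U i j * coef V k l - coef U k l * coef V i j.

Definition wedge_nonzero (U V : M2) : Prop :=
  exists i j k l : nat, wedge U V i j k l <> 0.

(** << U /\ V, W /\ Z >> *)
Definition biv_inner (U V W Z : M2) : R :=
  inner U W * inner V Z - inner U Z * inner V W.

Definition in_AdS (X : M2) : Prop := det2 X = 1.

Definition future_directed (X T : M2) : Prop := 0 < biv_inner I2 J2 X T.

Definition mDerive_n (g : R -> M2) (n : nat) (s : R) : M2 :=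
  mk_matrix 2 2 (fun i j => Derive_n (fun u => coef (g u) i j) n s).

Definition msmooth1 (J : R -> Prop) (g : R -> M2) : Prop :=
  forall i j : nat, (i < 2)%nat -> (j < 2)%nat ->
    smooth1 J (fun s => coef (g s) i j).

Definition msmooth2 (J K : R -> Prop) (g : R -> R -> M2) : Prop :=
  forall i j : nat, (i < 2)%nat -> (j < 2)%nat ->
    smooth2 J K (fun s t => coef (g s t) i j).

Record null_curve (J : R -> Prop) (g : R -> M2) : Prop := {
  nc_smooth : msmooth1 J g;
  nc_AdS : forall s, J s -> in_AdS (g s);
  nc_immersed : forall s, J s -> mDerive_n g 1 s <> mzero;
  nc_null : forall s, J s -> inner (mDerive_n g 1 s) (mDerive_n g 1 s) = 0;
  nc_future : forall s, J s -> future_directed (g s) (mDerive_n g 1 s);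
  nc_no_inflection : forall s, J s ->
    wedge_nonzero (mDerive_n g 1 s) (mDerive_n g 2 s);
  nc_proper_time : forall s, J s ->
    inner (mDerive_n g 2 s) (mDerive_n g 2 s) = 4
}.

Definition bending (g : R -> M2) (s : R) : R :=
  - (1 / 16) * inner (mDerive_n g 3 s) (mDerive_n g 3 s).

Record spinor_frame (J : R -> Prop) (g Fp Fm : R -> M2) : Prop := {
  sf_smooth_p : msmooth1 J Fp;
  sf_smooth_m : msmooth1 J Fm;
  sf_SL_p : forall s, J s -> det2 (Fp s) = 1;
  sf_SL_m : forall s, J s -> det2 (Fm s) = 1;
  sf_curve : forall s, J s -> g s = mul (Fp s) (inv2 (Fm s));
  sf_deriv_p : forall s, J s ->
    mDerive_n Fp 1 s = mul (Fp s) (mat2 0 (bending g s + 1) 1 0);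
  sf_deriv_m : forall s, J s ->
    mDerive_n Fm 1 s = mul (Fm s) (mat2 0 (bending g s - 1) 1 0)
}.

Definition curve_at (g : R -> R -> M2) (t : R) : R -> M2 := fun s => g s t.

Definition flow_bending (g : R -> R -> M2) (s t : R) : R :=
  bending (curve_at g t) s.

Record LIEN_solution (J K : R -> Prop) (g : R -> R -> M2) : Prop := {
  lien_smooth : msmooth2 J K g;
  lien_null : forall t, K t -> null_curve J (curve_at g t);
  lien_eq : forall s t, J s -> K t ->
    mDerive_n (fun v => g s v) 1 t =
    madd (mscal 2 (mDerive_n (curve_at g t) 3 s))
         (mscal (- 6 * flow_bending g s t) (mDerive_n (curve_at g t) 1 s))
}.

Record spinor_frame_field (J K : R -> Prop) (g Fp Fm : R -> R -> M2) : Prop := {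
  sff_smooth_p : msmooth2 J K Fp;
  sff_smooth_m : msmooth2 J K Fm;
  sff_frame : forall t, K t ->
    spinor_frame J (curve_at g t) (curve_at Fp t) (curve_at Fm t)
}.

Definition KdV_solution (J K : R -> Prop) (k : R -> R -> R) : Prop :=
  smooth2 J K k /\
  forall s t, J s -> K t ->
    Derive (fun v => k s v) t + Derive_n (fun u => k u t) 3 s
    - 6 * k s t * Derive (fun u => k u t) s = 0.

(** [differentiable_pt_lim f s t p q]: [f] is differentiable at [(s, t)], with
    differential [p ds + q dt]. *)
Definition WE_solution (J K : R -> Prop) (k : R -> R -> R) (lam : R)
    (f : R -> R -> R) : Prop :=
  forall s t, J s -> K t ->
    differentiable_pt_lim f s t
      (k s t - f s t ^ 2 + lam)
      (4 * lam * (f s t ^ 2 - lam) - 2 * k s t * (f s t ^ 2 + lam)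
       + 2 * k s t ^ 2 + 2 * f s t * Derive (fun u => k u t) s
       - Derive_n (fun u => k u t) 2 s).

Definition T_matrix (xi f : R) : M2 :=
  mat2 (tanh xi) (- (csch xi * sech xi * f)) 0 (coth xi).

(** [g'] is the T-transform of [g] with parameter [xi] and transforming
    function [f], for the global choice of sign [eps] (either 1 or -1).  A
    spinor frame field is unique up to a common sign of [Fp] and [Fm], which
    cancels in the formula, so [g'] is determined on [J x K]. *)
Record T_transform (J K : R -> Prop) (eps xi : R) (f : R -> R -> R)
    (g g' : R -> R -> M2) : Prop := {
  T_lien : LIEN_solution J K g;
  T_param : xi <> 0;
  T_fun : WE_solution J K (flow_bending g) (cosh (2 * xi)) f;
  T_formula : exists Fp Fm : R -> R -> M2,
    spinor_frame_field J K g Fp Fm /\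
    forall s t, J s -> K t ->
      g' s t = mscal eps
        (mul (mul (Fp s t) (T_matrix xi (f s t))) (inv2 (Fm s t)))
}.

(* Main.v *)
Require Import Defs.
From Stdlib Require Import Reals Lra Lia Classical.
From Coquelicot Require Import Coquelicot.
Open Scope R_scope.

(** A null curve is encoded by its spinor frames [Fp], [Fm], which solve the
    Schroedinger equation [y'' = (k + mu) y] (written as a first order system)
    for the two spectral values [mu = 1] and [mu = -1].  The proof is the
    dressing argument for the KdV hierarchy, run at these two values at once.

    - Any pair of frames in [SL(2)] solving these two equations for
      some function [k] yields a null curve [Fp Fm^-1] with bending [k]
      ([moving_frame_null_curve]).  When the curve moves by the LIEN flow, its
      frames also satisfy [F_t = F A] with [A] the time part of the KdV Lax pair
      ([LIEN_lax_frames]); this is forced by the flow and by the equality of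
      mixed derivatives, and it also gives the KdV equation for the bending
      ([lax_frame_KdV]).  Conversely, a pair of solutions of the Lax system gives
      a solution of the flow ([lax_frames_LIEN]).

    - A solution [f] of the Wahlquist-Estabrook equation for [lam] defines a
      Darboux matrix [darboux lam mu f] of determinant [lam - mu] that takes
      solutions of the Lax system for [k] to solutions for
      [2 f^2 - 2 lam - k] ([darboux_lax_frame]).  The matrix of the transform
      is the quotient of the normalized Darboux matrices at [mu = 1] and
      [mu = -1] ([T_matrix_darboux]): [lam - 1] and [lam + 1] are
      [2 sinh^2 xi] and [2 cosh^2 xi] when [lam = cosh (2 xi)].  Hence the
      transform of a flow is a flow, with an explicit spinor frame field
      ([T_transform_frames]).  Frames being unique up to sign
      ([spinor_frame_unique]), the frame field used in its definition is
      immaterial.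

    - Iterating two transforms multiplies two Darboux matrices, and the product
      is symmetric in the two transforms ([darboux_permutability]); so the two
      iterated flows coincide.  That the permuted functions solve the
      Wahlquist-Estabrook equation ([WE_permuted]) and that the bending of the
      result is the given one are then algebraic identities; the bending solves
      KdV because it is the bending of a flow. *)

(** * Smooth functions on an open rectangle *)

Lemma open_interval_open : forall J : R -> Prop, is_open_interval J -> open J.
Proof.
  intros J (a & b & _ & HJ).
  apply (open_ext (fun x : R => Rbar_lt a x /\ Rbar_lt x b)).
  - intros x. symmetry. apply HJ.
  - apply (open_and (fun x : R => Rbar_lt a x) (fun x : R => Rbar_lt x b));
      [apply open_Rbar_gt | apply open_Rbar_lt].
Qed.

Lemma open_near : forall (J P : R -> Prop) (s : R), open J -> J s ->
  (forall u, J u -> P u) -> locally s P.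
Proof.
  intros J P s oJ Js H. apply (filter_imp J); [exact H | exact (oJ s Js)].
Qed.

Lemma open_near_2d : forall (J K : R -> Prop) (P : R -> R -> Prop) (s t : R),
  open J -> open K -> J s -> K t ->
  (forall u v, J u -> K v -> P u v) -> locally_2d P s t.
Proof.
  intros J K P s t oJ oK Js Kt H.
  destruct (oJ s Js) as [d1 H1]. destruct (oK t Kt) as [d2 H2].
  assert (Hd : 0 < Rmin d1 d2) by (apply Rmin_pos; apply cond_pos).
  exists (mkposreal _ Hd). simpl. intros u v Hu Hv. apply H.
  - apply H1. apply Rlt_le_trans with (1 := Hu). apply Rmin_l.
  - apply H2. apply Rlt_le_trans with (1 := Hv). apply Rmin_r.
Qed.

(** [is_derive_unique] at the type [R -> R], in the syntactic form that
    [auto_derive] leaves behind. *)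
Lemma Derive_val : forall (f : R -> R) (x l : R), is_derive f x l -> Derive f x = l.
Proof. exact is_derive_unique. Qed.

Definition ds (f : R -> R -> R) : R -> R -> R := fun s t => Derive (fun u => f u t) s.
Definition dt (f : R -> R -> R) : R -> R -> R := fun s t => Derive (fun v => f s v) t.

Definition Cn (J K : R -> Prop) (n : nat) (f : R -> R -> R) : Prop :=
  forall s t, J s -> K t -> ex_diff_n f n s t.

Lemma Cn_ext : forall J K n f g, open J -> open K ->
  (forall s t, J s -> K t -> f s t = g s t) -> Cn J K n f -> Cn J K n g.
Proof.
  intros J K n f g oJ oK E H s t Js Kt.
  apply (ex_diff_n_ext_loc f); [| now apply H].
  now apply (open_near_2d J K).
Qed.

Lemma Cn_continuity : forall J K n f s t, Cn J K n f -> J s -> K t ->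
  continuity_2d_pt f s t.
Proof. intros J K n f s t H Js Kt. destruct n; apply (H s t Js Kt). Qed.

Lemma Cn_weaken : forall J K n f, Cn J K (S n) f -> Cn J K n f.
Proof.
  intros J K n f H s t Js Kt. apply (ex_diff_n_m (S n)); [lia | now apply H].
Qed.

Lemma Cn_ds : forall J K n f, Cn J K (S n) f -> Cn J K n (ds f).
Proof. intros J K n f H s t Js Kt. apply (H s t Js Kt). Qed.

Lemma Cn_dt : forall J K n f, Cn J K (S n) f -> Cn J K n (dt f).
Proof. intros J K n f H s t Js Kt. apply (H s t Js Kt). Qed.

Lemma Cn_is_derive_s : forall J K n f s t, Cn J K (S n) f -> J s -> K t ->
  is_derive (fun u => f u t) s (ds f s t).
Proof. intros J K n f s t H Js Kt. apply Derive_correct. apply (H s t Js Kt). Qed.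

Lemma Cn_is_derive_t : forall J K n f s t, Cn J K (S n) f -> J s -> K t ->
  is_derive (fun v => f s v) t (dt f s t).
Proof. intros J K n f s t H Js Kt. apply Derive_correct. apply (H s t Js Kt). Qed.

(** The converse of the four lemmas before it, and the step of every induction
    on the order of differentiability: the partial derivatives may be given
    by formulas [p], [q] valid on the rectangle only. *)
Lemma Cn_S_intro : forall J K n f p q, open J -> open K ->
  (forall s t, J s -> K t -> continuity_2d_pt f s t) ->
  (forall s t, J s -> K t -> is_derive (fun u => f u t) s (p s t)) ->
  (forall s t, J s -> K t -> is_derive (fun v => f s v) t (q s t)) ->
  Cn J K n p -> Cn J K n q -> Cn J K (S n) f.
Proof.
  intros J K n f p q oJ oK cf fs ft Hp Hq s t Js Kt.
  split; [now apply cf |].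
  split; [eexists; now apply fs |].
  split; [eexists; now apply ft |].
  split.
  - apply (Cn_ext J K n p); trivial.
    intros u v Ju Kv. symmetry. apply is_derive_unique. now apply fs.
  - apply (Cn_ext J K n q); trivial.
    intros u v Ju Kv. symmetry. apply is_derive_unique. now apply ft.
Qed.

Lemma Cn_const : forall J K n c, Cn J K n (fun _ _ => c).
Proof.
  intros J K n. induction n as [|n IH]; intros c s t Js Kt.
  - split; [apply continuity_2d_pt_const | trivial].
  - split; [apply continuity_2d_pt_const |].
    split; [apply ex_derive_const |].
    split; [apply ex_derive_const |].
    split.
    + apply (ex_diff_n_ext_loc (fun _ _ => 0)); [| now apply IH].
      exists (mkposreal 1 Rlt_0_1). intros u v _ _. now rewrite Derive_const.
    + apply (ex_diff_n_ext_loc (fun _ _ => 0)); [| now apply IH].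
      exists (mkposreal 1 Rlt_0_1). intros u v _ _. now rewrite Derive_const.
Qed.

Lemma Cn_plus : forall J K, open J -> open K -> forall n f g,
  Cn J K n f -> Cn J K n g -> Cn J K n (fun s t => f s t + g s t).
Proof.
  intros J K oJ oK n. induction n as [|n IH]; intros f g Hf Hg.
  - intros s t Js Kt. split; [| trivial].
    apply continuity_2d_pt_plus; [now apply Hf | now apply Hg].
  - apply (Cn_S_intro J K n _ (fun s t => ds f s t + ds g s t)
             (fun s t => dt f s t + dt g s t)); trivial.
    + intros s t Js Kt. apply continuity_2d_pt_plus; [now apply Hf | now apply Hg].
    + intros s t Js Kt. apply (is_derive_plus (fun u => f u t) (fun u => g u t));
        now apply (Cn_is_derive_s J K n).
    + intros s t Js Kt. apply (is_derive_plus (fun v => f s v) (fun v => g s v));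
        now apply (Cn_is_derive_t J K n).
    + apply IH; now apply Cn_ds.
    + apply IH; now apply Cn_dt.
Qed.

Lemma Cn_mult : forall J K, open J -> open K -> forall n f g,
  Cn J K n f -> Cn J K n g -> Cn J K n (fun s t => f s t * g s t).
Proof.
  intros J K oJ oK n. induction n as [|n IH]; intros f g Hf Hg.
  - intros s t Js Kt. split; [| trivial].
    apply continuity_2d_pt_mult; [now apply Hf | now apply Hg].
  - apply (Cn_S_intro J K n _ (fun s t => ds f s t * g s t + f s t * ds g s t)
             (fun s t => dt f s t * g s t + f s t * dt g s t)); trivial.
    + intros s t Js Kt. apply continuity_2d_pt_mult; [now apply Hf | now apply Hg].
    + intros s t Js Kt.
      apply (is_derive_mult (fun u => f u t) (fun u => g u t));
        [now apply (Cn_is_derive_s J K n) | now apply (Cn_is_derive_s J K n)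
        | exact Rmult_comm].
    + intros s t Js Kt.
      apply (is_derive_mult (fun v => f s v) (fun v => g s v));
        [now apply (Cn_is_derive_t J K n) | now apply (Cn_is_derive_t J K n)
        | exact Rmult_comm].
    + apply Cn_plus; trivial; apply IH;
        first [now apply Cn_ds | now apply Cn_weaken].
    + apply Cn_plus; trivial; apply IH;
        first [now apply Cn_dt | now apply Cn_weaken].
Qed.

Lemma Cn_inv : forall J K, open J -> open K -> forall n f,
  (forall s t, J s -> K t -> f s t <> 0) ->
  Cn J K n f -> Cn J K n (fun s t => / f s t).
Proof.
  intros J K oJ oK n f nz. induction n as [|n IH]; intros Hf.
  - intros s t Js Kt. split; [| trivial].
    apply continuity_2d_pt_inv; [now apply Hf | now apply nz].
  - assert (Hg : Cn J K n (fun s t => / f s t)) by (apply IH; now apply Cn_weaken).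
    (* [/ f] is differentiated through [/ f] itself, already known to be [C^n]. *)
    apply (Cn_S_intro J K n _ (fun s t => (-1) * (ds f s t * (/ f s t * / f s t)))
             (fun s t => (-1) * (dt f s t * (/ f s t * / f s t)))); trivial.
    + intros s t Js Kt. apply continuity_2d_pt_inv; [now apply Hf | now apply nz].
    + intros s t Js Kt. evar_last.
      * apply (is_derive_inv (fun u => f u t));
          [now apply (Cn_is_derive_s J K n) | now apply nz].
      * simpl. field. now apply nz.
    + intros s t Js Kt. evar_last.
      * apply (is_derive_inv (fun v => f s v));
          [now apply (Cn_is_derive_t J K n) | now apply nz].
      * simpl. field. now apply nz.
    + repeat apply Cn_mult; trivial; [apply Cn_const | now apply Cn_ds].
    + repeat apply Cn_mult; trivial; [apply Cn_const | now apply Cn_dt].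
Qed.

Lemma smooth2_ext : forall J K f g, open J -> open K ->
  (forall s t, J s -> K t -> f s t = g s t) -> smooth2 J K f -> smooth2 J K g.
Proof. intros J K f g oJ oK E H n. apply (Cn_ext J K n f); trivial. exact (H n). Qed.

Lemma smooth2_const : forall J K c, smooth2 J K (fun _ _ => c).
Proof. intros J K c n. apply Cn_const. Qed.

Lemma smooth2_plus : forall J K f g, open J -> open K ->
  smooth2 J K f -> smooth2 J K g -> smooth2 J K (fun s t => f s t + g s t).
Proof. intros J K f g oJ oK Hf Hg n. apply Cn_plus; trivial; [exact (Hf n) | exact (Hg n)]. Qed.

Lemma smooth2_mult : forall J K f g, open J -> open K ->
  smooth2 J K f -> smooth2 J K g -> smooth2 J K (fun s t => f s t * g s t).
Proof. intros J K f g oJ oK Hf Hg n. apply Cn_mult; trivial; [exact (Hf n) | exact (Hg n)]. Qed.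

Lemma smooth2_opp : forall J K f, open J -> open K ->
  smooth2 J K f -> smooth2 J K (fun s t => - f s t).
Proof.
  intros J K f oJ oK Hf. apply (smooth2_ext J K (fun s t => (-1) * f s t)); trivial.
  - intros s t _ _. ring.
  - apply (smooth2_mult J K (fun _ _ => -1) f); trivial. apply smooth2_const.
Qed.

Lemma smooth2_minus : forall J K f g, open J -> open K ->
  smooth2 J K f -> smooth2 J K g -> smooth2 J K (fun s t => f s t - g s t).
Proof.
  intros J K f g oJ oK Hf Hg.
  apply (smooth2_plus J K f (fun s t => - g s t)); trivial. now apply smooth2_opp.
Qed.

Lemma smooth2_pow : forall J K f n, open J -> open K ->
  smooth2 J K f -> smooth2 J K (fun s t => f s t ^ n).
Proof.
  intros J K f n oJ oK Hf. induction n as [|n IH]; simpl.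
  - apply smooth2_const.
  - now apply smooth2_mult.
Qed.

Lemma smooth2_inv : forall J K f, open J -> open K ->
  (forall s t, J s -> K t -> f s t <> 0) ->
  smooth2 J K f -> smooth2 J K (fun s t => / f s t).
Proof. intros J K f oJ oK nz Hf n. apply Cn_inv; trivial. exact (Hf n). Qed.

Lemma smooth2_ds : forall J K f, smooth2 J K f -> smooth2 J K (ds f).
Proof. intros J K f H n. apply (Cn_ds J K n f). exact (H (S n)). Qed.

Lemma smooth2_dt : forall J K f, smooth2 J K f -> smooth2 J K (dt f).
Proof. intros J K f H n. apply (Cn_dt J K n f). exact (H (S n)). Qed.

Lemma smooth2_is_derive_s : forall J K f s t, smooth2 J K f -> J s -> K t ->
  is_derive (fun u => f u t) s (ds f s t).
Proof. intros J K f s t H Js Kt. apply (Cn_is_derive_s J K 0); trivial. exact (H 1%nat). Qed.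

Lemma smooth2_is_derive_t : forall J K f s t, smooth2 J K f -> J s -> K t ->
  is_derive (fun v => f s v) t (dt f s t).
Proof. intros J K f s t H Js Kt. apply (Cn_is_derive_t J K 0); trivial. exact (H 1%nat). Qed.

Ltac smooth2 :=
  repeat first
    [ assumption
    | apply smooth2_const
    | apply smooth2_ds
    | apply smooth2_plus | apply smooth2_minus | apply smooth2_opp
    | apply smooth2_mult | apply smooth2_pow | apply smooth2_inv ].

Lemma smooth2_Derive_n_slice : forall J K f t n, open J -> K t -> smooth2 J K f ->
  exists h, smooth2 J K h /\ forall s, J s -> Derive_n (fun u => f u t) n s = h s t.
Proof.
  intros J K f t n oJ Kt Hf. induction n as [|n (h & Hh & E)].
  - exists f. split; [exact Hf | reflexivity].
  - exists (ds h). split; [now apply smooth2_ds |].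
    intros s Js. simpl. apply Derive_ext_loc. now apply (open_near J).
Qed.

Lemma smooth2_slice : forall J K f t, open J -> K t -> smooth2 J K f ->
  smooth1 J (fun s => f s t).
Proof.
  intros J K f t oJ Kt Hf n s Js. destruct n as [|n]; [exact I |]. simpl.
  destruct (smooth2_Derive_n_slice J K f t n oJ Kt Hf) as (h & Hh & E).
  apply (ex_derive_ext_loc (fun u => h u t)).
  - apply (open_near J); trivial. intros u Ju. symmetry. now apply E.
  - eexists. now apply (smooth2_is_derive_s J K).
Qed.

(** Symmetry of second derivatives, with both first derivatives given by
    formulas valid on the rectangle. *)
Lemma mixed_partials : forall J K f p q s t a b, open J -> open K ->
  smooth2 J K f -> J s -> K t ->
  (forall u v, J u -> K v -> is_derive (fun x => f x v) u (p u v)) ->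
  (forall u v, J u -> K v -> is_derive (fun y => f u y) v (q u v)) ->
  is_derive (fun v => p s v) t a -> is_derive (fun u => q u t) s b -> a = b.
Proof.
  intros J K f p q s t a b oJ oK Hf Js Kt fs ft pt qs.
  rewrite <- (is_derive_unique _ _ _ pt), <- (is_derive_unique _ _ _ qs).
  rewrite (Derive_ext_loc (fun v => p s v) (fun v => ds f s v)).
  2: { apply (open_near K); trivial. intros v Kv. symmetry.
       apply is_derive_unique. now apply fs. }
  rewrite (Derive_ext_loc (fun u => q u t) (fun u => dt f u t)).
  2: { apply (open_near J); trivial. intros u Ju. symmetry.
       apply is_derive_unique. now apply ft. }
  symmetry. apply Schwarz.
  - apply (open_near_2d J K); trivial. intros u v Ju Kv.
    split; [eexists; now apply fs |].
    split; [eexists; now apply ft |].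
    split; eexists.
    + apply (smooth2_is_derive_s J K (dt f)); trivial. now apply smooth2_dt.
    + apply (smooth2_is_derive_t J K (ds f)); trivial. now apply smooth2_ds.
  - apply (Cn_continuity J K 0 (ds (dt f))); trivial.
    exact (smooth2_ds _ _ _ (smooth2_dt _ _ _ Hf) 0%nat).
  - apply (Cn_continuity J K 0 (dt (ds f))); trivial.
    exact (smooth2_dt _ _ _ (smooth2_ds _ _ _ Hf) 0%nat).
Qed.

Lemma smooth2_differentiable : forall J K f s t p q, open J -> open K ->
  smooth2 J K f -> J s -> K t ->
  is_derive (fun u => f u t) s p -> is_derive (fun v => f s v) t q ->
  differentiable_pt_lim f s t p q.
Proof.
  intros J K f s t p q oJ oK Hf Js Kt fs ft.
  apply filterdiff_differentiable_pt_lim.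
  rewrite <- (is_derive_unique _ _ _ fs).
  apply (is_derive_filterdiff f s t (ds f) q); trivial.
  - apply (locally_2d_locally
      (fun u v => is_derive (fun z => f z v) u (ds f u v)) s t).
    apply (open_near_2d J K); trivial.
    intros u v Ju Kv. now apply (smooth2_is_derive_s J K).
  - apply continuity_2d_pt_filterlim.
    apply (Cn_continuity J K 0 (ds f)); trivial. exact (smooth2_ds _ _ _ Hf 0%nat).
Qed.

Lemma differentiable_is_derive : forall f s t p q,
  differentiable_pt_lim f s t p q ->
  is_derive (fun u => f u t) s p /\ is_derive (fun v => f s v) t q.
Proof.
  intros f s t p q H. split; apply is_derive_Reals.
  - replace p with (p * 1 + q * 0) by ring.
    apply (derivable_pt_lim_comp_2d f (fun u => u) (fun _ => t) s); trivial.
    + apply derivable_pt_lim_id.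
    + apply derivable_pt_lim_const.
  - replace q with (p * 0 + q * 1) by ring.
    apply (derivable_pt_lim_comp_2d f (fun _ => s) (fun v => v) t); trivial.
    + apply derivable_pt_lim_const.
    + apply derivable_pt_lim_id.
Qed.

(** * Two-by-two matrices and their derivatives *)

Definition adj2 (A : M2) : M2 :=
  mat2 (coef A 1 1) (- coef A 0 1) (- coef A 1 0) (coef A 0 0).

Lemma mat2_cases : forall A : M2, exists a b c d : R, A = mat2 a b c d.
Proof. intros [[a [b []]] [[c [d []]] []]]. now exists a, b, c, d. Qed.

Lemma mat2_inj : forall a b c d a' b' c' d',
  mat2 a b c d = mat2 a' b' c' d' -> a = a' /\ b = b' /\ c = c' /\ d = d'.
Proof. intros a b c d a' b' c' d' E. injection E. intuition. Qed.

Lemma mat2_coef : forall A : M2, A = mat2 (coef A 0 0) (coef A 0 1) (coef A 1 0) (coef A 1 1).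
Proof. intros A. now destruct (mat2_cases A) as (a & b & c & d & ->). Qed.

Lemma mul_mat2 : forall a b c d a' b' c' d',
  mul (mat2 a b c d) (mat2 a' b' c' d') =
  mat2 (a * a' + b * c') (a * b' + b * d') (c * a' + d * c') (c * b' + d * d').
Proof.
  intros. unfold mul, Mmult, mk_matrix. simpl mk_Tn. simpl Init.Nat.pred.
  rewrite !sum_Sn, !sum_O. reflexivity.
Qed.

Lemma madd_mat2 : forall a b c d a' b' c' d',
  madd (mat2 a b c d) (mat2 a' b' c' d') = mat2 (a + a') (b + b') (c + c') (d + d').
Proof. reflexivity. Qed.

Lemma mscal_mat2 : forall x a b c d,
  mscal x (mat2 a b c d) = mat2 (x * a) (x * b) (x * c) (x * d).
Proof. reflexivity. Qed.

Lemma adj2_mat2 : forall a b c d, adj2 (mat2 a b c d) = mat2 d (- b) (- c) a.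
Proof. reflexivity. Qed.

Lemma det2_mat2 : forall a b c d, det2 (mat2 a b c d) = a * d - b * c.
Proof. reflexivity. Qed.

Lemma coef_mat2_00 : forall a b c d, coef (mat2 a b c d) 0 0 = a.
Proof. reflexivity. Qed.

Lemma coef_mat2_01 : forall a b c d, coef (mat2 a b c d) 0 1 = b.
Proof. reflexivity. Qed.

Lemma coef_mat2_10 : forall a b c d, coef (mat2 a b c d) 1 0 = c.
Proof. reflexivity. Qed.

Lemma coef_mat2_11 : forall a b c d, coef (mat2 a b c d) 1 1 = d.
Proof. reflexivity. Qed.

(** Three rounds, because a product of products is a product of explicit
    matrices only once its factors have been computed. *)
Ltac entries :=
  unfold I2, J2, mzero in *;
  repeat match goal with
    | A : M2 |- _ =>
        let E := fresh in
        destruct (mat2_cases A) as (? & ? & ? & ? & E); subst A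
    end;
  do 3 rewrite ?mul_mat2, ?adj2_mat2, ?mscal_mat2, ?madd_mat2, ?det2_mat2,
    ?coef_mat2_00, ?coef_mat2_01, ?coef_mat2_10, ?coef_mat2_11 in *.

Lemma mul_assoc : forall A B C : M2, mul A (mul B C) = mul (mul A B) C.
Proof. intros A B C. entries. f_equal; ring. Qed.

Lemma mul_1_r : forall A : M2, mul A I2 = A.
Proof. intros A. entries. f_equal; ring. Qed.

Lemma mul_1_l : forall A : M2, mul I2 A = A.
Proof. intros A. entries. f_equal; ring. Qed.

Lemma mul_adj_r : forall A : M2, det2 A = 1 -> mul A (adj2 A) = I2.
Proof. intros A HA. entries. rewrite <- HA. f_equal; ring. Qed.

Lemma mul_adj_l : forall A : M2, det2 A = 1 -> mul (adj2 A) A = I2.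
Proof. intros A HA. entries. rewrite <- HA. f_equal; ring. Qed.

Lemma det2_mul : forall A B : M2, det2 (mul A B) = det2 A * det2 B.
Proof. intros A B. entries. ring. Qed.

Lemma det2_adj2 : forall A : M2, det2 (adj2 A) = det2 A.
Proof. intros A. entries. ring. Qed.

Lemma det2_mscal : forall x A, det2 (mscal x A) = x * x * det2 A.
Proof. intros x A. entries. ring. Qed.

Lemma inv2_SL : forall A : M2, det2 A = 1 -> inv2 A = adj2 A.
Proof.
  intros A HA. change (inv2 A) with (mscal (/ det2 A) (adj2 A)).
  rewrite HA. clear HA. entries. f_equal; field.
Qed.

Lemma mul_cancel_l : forall A B C : M2, det2 A = 1 -> mul A B = mul A C -> B = C.
Proof.
  intros A B C HA E.
  rewrite <- (mul_1_l B), <- (mul_1_l C), <- (mul_adj_l A HA), <- !mul_assoc.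
  now rewrite E.
Qed.

Lemma mul_cancel_r : forall A B C : M2, det2 A = 1 -> mul B A = mul C A -> B = C.
Proof.
  intros A B C HA E.
  rewrite <- (mul_1_r B), <- (mul_1_r C), <- (mul_adj_r A HA), !mul_assoc.
  now rewrite E.
Qed.

Lemma inner_self : forall X : M2, inner X X = - det2 X.
Proof. intros X. unfold inner. entries. field. Qed.

Lemma coef_mul : forall (A B : M2) i j, (i < 2)%nat -> (j < 2)%nat ->
  coef (mul A B) i j = coef A i 0 * coef B 0 j + coef A i 1 * coef B 1 j.
Proof.
  intros A B i j Hi Hj. entries.
  destruct i as [|[|i]]; [| | lia]; destruct j as [|[|j]]; solve [reflexivity | lia].
Qed.

Lemma coef_madd : forall (A B : M2) i j, (i < 2)%nat -> (j < 2)%nat ->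
  coef (madd A B) i j = coef A i j + coef B i j.
Proof.
  intros A B i j Hi Hj. entries.
  destruct i as [|[|i]]; [| | lia]; destruct j as [|[|j]]; solve [reflexivity | lia].
Qed.

Lemma coef_mscal : forall x (A : M2) i j, (i < 2)%nat -> (j < 2)%nat ->
  coef (mscal x A) i j = x * coef A i j.
Proof.
  intros x A i j Hi Hj. entries.
  destruct i as [|[|i]]; [| | lia]; destruct j as [|[|j]]; solve [reflexivity | lia].
Qed.

Lemma coef_mDerive_n : forall g n s i j, (i < 2)%nat -> (j < 2)%nat ->
  coef (mDerive_n g n s) i j = Derive_n (fun u => coef (g u) i j) n s.
Proof.
  intros g n s i j Hi Hj. unfold mDerive_n.
  destruct i as [|[|i]]; [| | lia]; destruct j as [|[|j]]; solve [reflexivity | lia].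
Qed.

Lemma M2_ext : forall A B : M2,
  (forall i j, (i < 2)%nat -> (j < 2)%nat -> coef A i j = coef B i j) -> A = B.
Proof.
  intros A B H. rewrite (mat2_coef A), (mat2_coef B).
  f_equal; apply H; lia.
Qed.

Definition is_mderive (F : R -> M2) (s : R) (A : M2) : Prop :=
  forall i j, (i < 2)%nat -> (j < 2)%nat ->
    is_derive (fun u => coef (F u) i j) s (coef A i j).

Lemma is_mderive_entries : forall a b c d s a' b' c' d',
  is_derive a s a' -> is_derive b s b' -> is_derive c s c' -> is_derive d s d' ->
  is_mderive (fun u => mat2 (a u) (b u) (c u) (d u)) s (mat2 a' b' c' d').
Proof.
  intros a b c d s a' b' c' d' Ha Hb Hc Hd i j Hi Hj.
  destruct i as [|[|i]]; [| | lia]; destruct j as [|[|j]]; solve [assumption | lia].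
Qed.

Lemma is_mderive_unique : forall F s A B, is_mderive F s A -> is_mderive F s B -> A = B.
Proof.
  intros F s A B HA HB. apply M2_ext. intros i j Hi Hj.
  now rewrite <- (is_derive_unique _ _ _ (HA i j Hi Hj)),
              <- (is_derive_unique _ _ _ (HB i j Hi Hj)).
Qed.

Lemma is_mderive_ext_on : forall (J : R -> Prop) F G s A, open J -> J s ->
  (forall u, J u -> F u = G u) -> is_mderive F s A -> is_mderive G s A.
Proof.
  intros J F G s A oJ Js E H i j Hi Hj.
  apply (is_derive_ext_loc (fun u => coef (F u) i j)); [| now apply H].
  apply (open_near J); trivial. intros u Ju. now rewrite E.
Qed.

Lemma is_mderive_const : forall A s, is_mderive (fun _ => A) s mzero.
Proof.
  intros A s. rewrite (mat2_coef A). apply is_mderive_entries; exact (is_derive_const _ _).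
Qed.

Lemma is_mderive_mul : forall F G s A B, is_mderive F s A -> is_mderive G s B ->
  is_mderive (fun u => mul (F u) (G u)) s (madd (mul A (G s)) (mul (F s) B)).
Proof.
  intros F G s A B HA HB i j Hi Hj.
  apply (is_derive_ext
    (fun u => coef (F u) i 0 * coef (G u) 0 j + coef (F u) i 1 * coef (G u) 1 j)).
  { intros u. now rewrite coef_mul. }
  rewrite coef_madd, !coef_mul by lia.
  assert (H01 : (0 < 2)%nat) by lia. assert (H11 : (1 < 2)%nat) by lia.
  evar_last.
  - apply (is_derive_plus (fun u => coef (F u) i 0 * coef (G u) 0 j)
                          (fun u => coef (F u) i 1 * coef (G u) 1 j)).
    + apply (is_derive_mult (fun u => coef (F u) i 0) (fun u => coef (G u) 0%nat j));
        [now apply HA | now apply HB | exact Rmult_comm].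
    + apply (is_derive_mult (fun u => coef (F u) i 1) (fun u => coef (G u) 1%nat j));
        [now apply HA | now apply HB | exact Rmult_comm].
  - unfold plus, mult; simpl. ring.
Qed.

Lemma is_mderive_adj2 : forall F s A, is_mderive F s A ->
  is_mderive (fun u => adj2 (F u)) s (adj2 A).
Proof.
  intros F s A H.
  apply (is_mderive_entries (fun u => coef (F u) 1 1) (fun u => - coef (F u) 0 1)
           (fun u => - coef (F u) 1 0) (fun u => coef (F u) 0 0));
    try apply (is_derive_opp (fun u => coef (F u) _ _)); apply H; lia.
Qed.

Lemma is_mderive_mscal : forall x F s A, is_mderive F s A ->
  is_mderive (fun u => mscal x (F u)) s (mscal x A).
Proof.
  intros x F s A H i j Hi Hj.
  apply (is_derive_ext (fun u => x * coef (F u) i j)).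
  { intros u. now rewrite coef_mscal. }
  rewrite coef_mscal by trivial. apply is_derive_scal. now apply H.
Qed.

Lemma mDerive_n_S : forall (J : R -> Prop) g G n s A, open J -> J s ->
  (forall u, J u -> mDerive_n g n u = G u) -> is_mderive G s A ->
  mDerive_n g (S n) s = A.
Proof.
  intros J g G n s A oJ Js E H. apply M2_ext. intros i j Hi Hj.
  rewrite coef_mDerive_n by trivial. simpl.
  apply is_derive_unique.
  apply (is_derive_ext_loc (fun u => coef (G u) i j)); [| now apply H].
  apply (open_near J); trivial. intros u Ju.
  now rewrite <- E, coef_mDerive_n.
Qed.

Lemma is_mderive_mDerive : forall (J : R -> Prop) g s, msmooth1 J g -> J s ->
  is_mderive g s (mDerive_n g 1 s).
Proof.
  intros J g s Hg Js i j Hi Hj. rewrite coef_mDerive_n by trivial.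
  apply Derive_correct. exact (Hg i j Hi Hj 1%nat s Js).
Qed.

(** If [F' = F A] and [G' = G B] with [B] traceless, then [adj2 G], the inverse
    of [G] when [det2 G = 1], satisfies [(adj2 G)' = - B (adj2 G)]; so the
    derivative of [F N (adj2 G)] has the same shape, [N] being replaced by
    [A N - N B]. *)
Lemma is_mderive_conj : forall F G s (A B N : M2), coef B 1 1 = - coef B 0 0 ->
  is_mderive F s (mul (F s) A) -> is_mderive G s (mul (G s) B) ->
  is_mderive (fun u => mul (mul (F u) N) (adj2 (G u))) s
    (mul (mul (F s) (madd (mul A N) (mscal (-1) (mul N B)))) (adj2 (G s))).
Proof.
  intros F G s A B N HB HF HG.
  assert (E : mul (mul (F s) (madd (mul A N) (mscal (-1) (mul N B)))) (adj2 (G s)) =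
    madd (mul (madd (mul (mul (F s) A) N) (mul (F s) mzero)) (adj2 (G s)))
         (mul (mul (F s) N) (adj2 (mul (G s) B)))).
  { rewrite (mat2_coef B), HB. generalize (F s) (G s) (coef B 0 0) (coef B 0 1) (coef B 1 0).
    intros X Y p q r. entries. f_equal; ring. }
  rewrite E.
  apply (is_mderive_mul (fun u => mul (F u) N) (fun u => adj2 (G u))).
  - apply (is_mderive_mul F (fun _ => N)); [exact HF | apply is_mderive_const].
  - now apply is_mderive_adj2.
Qed.

(** * Null curves from spinor frames *)

Definition lax_s (q : R) : M2 := mat2 0 q 1 0.

Record moving_frame (J : R -> Prop) (k : R -> R) (Fp Fm : R -> M2) : Prop := {
  mf_SL_p : forall s, J s -> det2 (Fp s) = 1;
  mf_SL_m : forall s, J s -> det2 (Fm s) = 1;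
  mf_p : forall s, J s -> is_mderive Fp s (mul (Fp s) (lax_s (k s + 1)));
  mf_m : forall s, J s -> is_mderive Fm s (mul (Fm s) (lax_s (k s - 1)))
}.

Lemma spinor_moving_frame : forall J g Fp Fm, spinor_frame J g Fp Fm ->
  moving_frame J (bending g) Fp Fm /\
  (forall s, J s -> g s = mul (Fp s) (adj2 (Fm s))).
Proof.
  intros J g Fp Fm [Sp Sm Dp Dm C Ep Em]. split; [split; trivial |].
  - intros s Js. unfold lax_s. rewrite <- Ep by trivial. now apply (is_mderive_mDerive J).
  - intros s Js. unfold lax_s. rewrite <- Em by trivial. now apply (is_mderive_mDerive J).
  - intros s Js. rewrite <- inv2_SL by auto. auto.
Qed.

(** [k] does not enter the first two derivatives because the two frames obey
    the same equation up to the constant matrix [lax_s (k + 1) - lax_s (k - 1)],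
    the one in the first line. *)
Lemma moving_frame_mDerive : forall J k Fp Fm g s, open J ->
  moving_frame J k Fp Fm -> (forall u, J u -> g u = mul (Fp u) (adj2 (Fm u))) -> J s ->
  mDerive_n g 1 s = mul (mul (Fp s) (mat2 0 2 0 0)) (adj2 (Fm s)) /\
  mDerive_n g 2 s = mul (mul (Fp s) (mat2 (-2) 0 0 2)) (adj2 (Fm s)) /\
  mDerive_n g 3 s = mul (mul (Fp s) (mat2 0 (4 * k s) (-4) 0)) (adj2 (Fm s)).
Proof.
  intros J k Fp Fm g s oJ [_ _ Hp Hm] Hg Js.
  assert (Step : forall n N N', 
    (forall u, J u -> mDerive_n g n u = mul (mul (Fp u) N) (adj2 (Fm u))) ->
    forall u, J u ->
    madd (mul (lax_s (k u + 1)) N) (mscal (-1) (mul N (lax_s (k u - 1)))) = N' ->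
    mDerive_n g (S n) u = mul (mul (Fp u) N') (adj2 (Fm u))).
  { intros n N N' E u Ju <-.
    apply (mDerive_n_S J g (fun u => mul (mul (Fp u) N) (adj2 (Fm u)))); trivial.
    apply is_mderive_conj; auto. unfold lax_s. entries. ring. }
  assert (E0 : forall u, J u -> mDerive_n g 0 u = mul (mul (Fp u) I2) (adj2 (Fm u))).
  { intros u Ju. rewrite mul_1_r, <- Hg by trivial. apply M2_ext.
    intros i j Hi Hj. now rewrite coef_mDerive_n. }
  assert (E1 : forall u, J u ->
    mDerive_n g 1 u = mul (mul (Fp u) (mat2 0 2 0 0)) (adj2 (Fm u))).
  { intros u Ju. apply (Step 0%nat I2); trivial.
    unfold lax_s. entries. f_equal; ring. }
  assert (E2 : forall u, J u ->
    mDerive_n g 2 u = mul (mul (Fp u) (mat2 (-2) 0 0 2)) (adj2 (Fm u))).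
  { intros u Ju. apply (Step 1%nat (mat2 0 2 0 0)); trivial.
    unfold lax_s. entries. f_equal; ring. }
  split; [now apply E1 | split; [now apply E2 |]].
  apply (Step 2%nat (mat2 (-2) 0 0 2)); trivial.
  unfold lax_s. entries. f_equal; ring.
Qed.

(** The pairing that defines the time orientation is half the sum of the squares
    of the entries in the first columns of [X] and [Y], neither of which vanishes. *)
Lemma frame_future_directed : forall X Y : M2, det2 X = 1 -> det2 Y = 1 ->
  future_directed (mul X (adj2 Y)) (mul (mul X (mat2 0 2 0 0)) (adj2 Y)).
Proof.
  intros X Y HX HY. unfold future_directed, biv_inner, inner.
  destruct (mat2_cases X) as (a & b & c & d & ->).
  destruct (mat2_cases Y) as (p & q & r & v & ->).
  rewrite det2_mat2 in HX, HY.
  match goal with |- 0 < ?e =>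
    replace e with (((a * a + c * c) * (p * v - q * r) + (p * p + r * r) * (a * d - b * c)) / 2)
      by (entries; field)
  end.
  rewrite HX, HY.
  assert (0 < a * a + c * c).
  { destruct (Req_dec a 0) as [-> | Ha]; [| nra].
    destruct (Req_dec c 0) as [-> | Hc]; [lra | nra]. }
  assert (0 <= p * p + r * r) by nra. lra.
Qed.

Lemma not_future_directed_0 : forall X, ~ future_directed X mzero.
Proof.
  intros X H. unfold future_directed, biv_inner, inner in H.
  match type of H with 0 < ?e => replace e with 0 in H by (entries; field) end. lra.
Qed.

(** If every component of [wedge U V] vanished, [V] would be a multiple of
    [U], hence isotropic like [U]. *)
Lemma wedge_null_nonzero : forall U V : M2,
  U <> mzero -> det2 U = 0 -> det2 V <> 0 -> wedge_nonzero U V.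
Proof.
  intros U V U0 HU HV. apply NNPP. intros N.
  assert (W : forall i j k l, wedge U V i j k l = 0).
  { intros i j k l. destruct (Req_dec (wedge U V i j k l) 0) as [E | E]; trivial.
    elim N. now exists i, j, k, l. }
  assert (H : forall i j, coef U i j = 0).
  { intros i j. destruct (Req_dec (coef U i j) 0) as [E | E]; trivial.
    elim HV. apply (Rmult_eq_reg_l (coef U i j * coef U i j)); [| nra].
    transitivity (coef V i j * coef V i j * det2 U); [| rewrite HU; ring].
    unfold det2.
    pose proof (W i j 0%nat 0%nat). pose proof (W i j 0%nat 1%nat).
    pose proof (W i j 1%nat 0%nat). pose proof (W i j 1%nat 1%nat).
    unfold wedge in *.
    transitivity ((coef U i j * coef V 0 0) * (coef U i j * coef V 1 1) -
                  (coef U i j * coef V 0 1) * (coef U i j * coef V 1 0)); [ring |].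
    replace (coef U i j * coef V 0 0) with (coef U 0 0 * coef V i j) by lra.
    replace (coef U i j * coef V 0 1) with (coef U 0 1 * coef V i j) by lra.
    replace (coef U i j * coef V 1 0) with (coef U 1 0 * coef V i j) by lra.
    replace (coef U i j * coef V 1 1) with (coef U 1 1 * coef V i j) by lra.
    ring. }
  apply U0. rewrite (mat2_coef U), !H. reflexivity.
Qed.

Lemma moving_frame_null_curve : forall J k Fp Fm g, open J ->
  moving_frame J k Fp Fm -> (forall u, J u -> g u = mul (Fp u) (adj2 (Fm u))) ->
  msmooth1 J g -> null_curve J g /\ forall s, J s -> bending g s = k s.
Proof.
  intros J k Fp Fm g oJ HF Hg Sg.
  pose proof (fun s => moving_frame_mDerive J k Fp Fm g s oJ HF Hg) as D.
  assert (SLp : forall s, J s -> det2 (Fp s) = 1) by apply HF.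
  assert (SLm : forall s, J s -> det2 (Fm s) = 1) by apply HF.
  assert (Fut : forall s, J s -> future_directed (g s) (mDerive_n g 1 s)).
  { intros s Js. destruct (D s Js) as (-> & _ & _). rewrite Hg by trivial.
    apply frame_future_directed; auto. }
  assert (N0 : forall s, J s -> mDerive_n g 1 s <> mzero).
  { intros s Js E. apply (not_future_directed_0 (g s)). rewrite <- E. auto. }
  assert (det1 : forall s, J s -> det2 (mDerive_n g 1 s) = 0).
  { intros s Js. destruct (D s Js) as (-> & _ & _).
    rewrite !det2_mul, det2_mat2. ring. }
  assert (det2' : forall s, J s -> det2 (mDerive_n g 2 s) = -4).
  { intros s Js. destruct (D s Js) as (_ & -> & _).
    rewrite !det2_mul, det2_mat2, det2_adj2, SLp, SLm by trivial. ring. }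
  split; [split; trivial |].
  - intros s Js. unfold in_AdS. rewrite Hg, det2_mul, det2_adj2, SLp, SLm by trivial. ring.
  - intros s Js. rewrite inner_self, det1 by trivial. ring.
  - intros s Js. apply wedge_null_nonzero; auto. rewrite det2' by trivial. lra.
  - intros s Js. rewrite inner_self, det2' by trivial. ring.
  - intros s Js. unfold bending. destruct (D s Js) as (_ & _ & ->).
    rewrite inner_self, !det2_mul, det2_mat2, det2_adj2, SLp, SLm by trivial. field.
Qed.

(** A frame is unique up to a sign, which may be read off point by point:
    [C = (adj2 Gp) Fp = (adj2 Gm) Fm] satisfies [C' = C L - L C] both for
    [L = lax_s (k + 1)] and for [L = lax_s (k - 1)].  So [C] commutes with the
    difference of the two and is upper triangular with equal diagonal entries;
    its derivative then forces the off-diagonal entry to vanish. *)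
Lemma spinor_frame_unique : forall J g Fp Fm Gp Gm s, open J ->
  spinor_frame J g Fp Fm -> spinor_frame J g Gp Gm -> J s ->
  exists c, c * c = 1 /\ Fp s = mscal c (Gp s) /\ Fm s = mscal c (Gm s).
Proof.
  intros J g Fp Fm Gp Gm s oJ HF HG Js.
  destruct (spinor_moving_frame _ _ _ _ HF) as [[dFp dFm Fp' Fm'] EF].
  destruct (spinor_moving_frame _ _ _ _ HG) as [[dGp dGm Gp' Gm'] EG].
  clear HF HG. set (k := bending g) in *.
  set (C := fun u => mul (adj2 (Gp u)) (Fp u)).
  assert (ECm : forall u, J u -> C u = mul (adj2 (Gm u)) (Fm u)).
  { intros u Ju. unfold C. apply (mul_cancel_l (Gp u)); auto.
    apply (mul_cancel_r (adj2 (Fm u))); [rewrite det2_adj2; auto |].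
    rewrite !mul_assoc, mul_adj_r, mul_1_l by auto.
    rewrite <- EF, <- (mul_assoc (mul _ _)), mul_adj_r, mul_1_r by auto. auto. }
  assert (dC : forall F G q u, is_mderive F u (mul (F u) (lax_s q)) ->
    is_mderive G u (mul (G u) (lax_s q)) -> forall c, mul (adj2 (G u)) (F u) = c ->
    is_mderive (fun v => mul (adj2 (G v)) (F v)) u
      (madd (mul c (lax_s q)) (mscal (-1) (mul (lax_s q) c)))).
  { intros F G q u HF HG c <-.
    replace (madd _ _) with
      (madd (mul (adj2 (mul (G u) (lax_s q))) (F u))
            (mul (adj2 (G u)) (mul (F u) (lax_s q)))).
    - apply (is_mderive_mul (fun v => adj2 (G v)) F); [now apply is_mderive_adj2 | exact HF].
    - generalize (F u) (G u). intros X Y. unfold lax_s. entries. f_equal; ring. }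
  assert (tri : forall u, J u -> exists x y, C u = mat2 x y 0 x).
  { intros u Ju.
    pose proof (dC Fp Gp _ u (Fp' u Ju) (Gp' u Ju) (C u) eq_refl) as D1.
    pose proof (dC Fm Gm _ u (Fm' u Ju) (Gm' u Ju) (C u) (eq_sym (ECm u Ju))) as D2.
    apply (is_mderive_ext_on J _ C) in D2; trivial;
      [| intros v Jv; symmetry; now apply ECm].
    pose proof (is_mderive_unique _ _ _ _ D1 D2) as E.
    destruct (mat2_cases (C u)) as (x & y & z & w & Ec). rewrite Ec in E |- *.
    unfold lax_s in E. entries. apply mat2_inj in E. destruct E as (E1 & E2 & _).
    exists x, y. f_equal; lra. }
  destruct (tri s Js) as (x & y & Ec).
  pose proof (dC Fp Gp _ s (Fp' s Js) (Gp' s Js) (C s) eq_refl) as D1.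
  assert (Hy : y = 0).
  { assert (H0 : (0 < 2)%nat) by lia. assert (H1 : (1 < 2)%nat) by lia.
    pose proof (D1 0%nat 0%nat H0 H0) as A. pose proof (D1 1%nat 1%nat H1 H1) as B.
    rewrite Ec in A, B.
    assert (AB : is_derive (fun u => coef (mul (adj2 (Gp u)) (Fp u)) 1 1) s
                   (coef (madd (mul (mat2 x y 0 x) (lax_s (k s + 1)))
                       (mscal (-1) (mul (lax_s (k s + 1)) (mat2 x y 0 x)))) 0 0)).
    { apply (is_derive_ext_loc (fun u => coef (mul (adj2 (Gp u)) (Fp u)) 0 0)); trivial.
      apply (open_near J); trivial. intros u Ju.
      destruct (tri u Ju) as (x' & y' & Eu). unfold C in Eu. now rewrite Eu. }
    pose proof (is_derive_unique _ _ _ AB) as A'.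
    pose proof (is_derive_unique _ _ _ B) as B'.
    rewrite A' in B'. unfold lax_s in B'. clear - B'. entries. lra. }
  subst y. exists x.
  assert (dC1 : det2 (C s) = 1).
  { unfold C. rewrite det2_mul, det2_adj2, dGp, dFp by trivial. ring. }
  rewrite Ec, det2_mat2 in dC1. split; [lra |].
  assert (scal : forall A : M2, mul A (mat2 x 0 0 x) = mscal x A).
  { intros A. entries. f_equal; ring. }
  split.
  - rewrite <- scal, <- Ec. unfold C. rewrite mul_assoc, mul_adj_r, mul_1_l; auto.
  - rewrite <- scal, <- Ec, ECm by trivial. rewrite mul_assoc, mul_adj_r, mul_1_l; auto.
Qed.

(** * The linear system behind the flow *)

(** The time part of the KdV Lax pair, of which [lax_s (k + mu)] is the space
    part.  In [lax_t k k1 k2 mu] the arguments [k], [k1], [k2] stand for the bending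
    and its first two derivatives in [s]. *)
Definition lax_t (k k1 k2 mu : R) : M2 :=
  mat2 (- k1) (- k2 + (k + mu) * (2 * k - 4 * mu)) (2 * k - 4 * mu) k1.

Record lax_frame (J K : R -> Prop) (mu : R) (k : R -> R -> R) (F : R -> R -> M2) : Prop := {
  lf_smooth : msmooth2 J K F;
  lf_SL : forall s t, J s -> K t -> det2 (F s t) = 1;
  lf_s : forall s t, J s -> K t ->
    is_mderive (fun u => F u t) s (mul (F s t) (lax_s (k s t + mu)));
  lf_t : forall s t, J s -> K t ->
    is_mderive (fun v => F s v) t
      (mul (F s t) (lax_t (k s t) (ds k s t) (ds (ds k) s t) mu))
}.

(** Equality of the mixed derivatives of [F], for [F_s = F L] and [F_t = F A],
    is the zero curvature equation [A_s = A L - L A + L_t]; these are its three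
    entries when [A] is traceless. *)
Lemma zero_curvature : forall J K F q a b c s t q' a' b' c', open J -> open K ->
  msmooth2 J K F -> (forall s t, J s -> K t -> det2 (F s t) = 1) ->
  (forall s t, J s -> K t -> is_mderive (fun u => F u t) s (mul (F s t) (lax_s (q s t)))) ->
  (forall s t, J s -> K t ->
     is_mderive (fun v => F s v) t (mul (F s t) (mat2 (a s t) (b s t) (c s t) (- a s t)))) ->
  J s -> K t ->
  is_derive (fun v => q s v) t q' -> is_derive (fun u => a u t) s a' ->
  is_derive (fun u => b u t) s b' -> is_derive (fun u => c u t) s c' ->
  a' = b s t - q s t * c s t /\ c' = - 2 * a s t /\ b' = 2 * a s t * q s t + q'.
Proof.
  intros J K F q a b c s t q' a' b' c' oJ oK SF dF Fs Ft Js Kt Hq Ha Hb Hc.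
  set (L := lax_s (q s t)). set (A := mat2 (a s t) (b s t) (c s t) (- a s t)).
  assert (D1 : is_mderive (fun v => mul (F s v) (lax_s (q s v))) t
                 (madd (mul (mul (F s t) A) L) (mul (F s t) (mat2 0 q' 0 0)))).
  { apply (is_mderive_mul (fun v => F s v) (fun v => lax_s (q s v))); [now apply Ft |].
    apply is_mderive_entries; trivial; exact (is_derive_const _ _). }
  assert (D2 : is_mderive (fun u => mul (F u t) (mat2 (a u t) (b u t) (c u t) (- a u t))) s
                 (madd (mul (mul (F s t) L) A) (mul (F s t) (mat2 a' b' c' (- a'))))).
  { apply (is_mderive_mul (fun u => F u t)
             (fun u => mat2 (a u t) (b u t) (c u t) (- a u t))); [now apply Fs |].
    apply is_mderive_entries; trivial. now apply (is_derive_opp (fun u => a u t)). }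
  assert (E : madd (mul (mul (F s t) A) L) (mul (F s t) (mat2 0 q' 0 0)) =
              madd (mul (mul (F s t) L) A) (mul (F s t) (mat2 a' b' c' (- a')))).
  { apply M2_ext. intros i j Hi Hj.
    apply (mixed_partials J K (fun s t => coef (F s t) i j)
             (fun s t => coef (mul (F s t) (lax_s (q s t))) i j)
             (fun s t => coef (mul (F s t) (mat2 (a s t) (b s t) (c s t) (- a s t))) i j) s t);
      trivial; try solve [now apply D1 | now apply D2 | now apply SF].
    - intros u v Ju Kv. now apply (Fs u v Ju Kv).
    - intros u v Ju Kv. now apply (Ft u v Ju Kv). }
  assert (E' : madd (mul A L) (mat2 0 q' 0 0) = madd (mul L A) (mat2 a' b' c' (- a'))).
  { apply (mul_cancel_l (F s t)); auto. clear - E.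
    revert E. generalize (F s t) A L. intros X Y Z E.
    assert (dist : forall U V W : M2, mul U (madd V W) = madd (mul U V) (mul U W)).
    { intros U V W. entries. f_equal; ring. }
    rewrite !dist, !mul_assoc. exact E. }
  unfold A, L, lax_s in E'. clear - E'. entries.
  apply mat2_inj in E'. destruct E' as (E1 & E2 & E3 & E4). lra.
Qed.

(** KdV is the upper right entry of the zero curvature equation. *)
Lemma lax_frame_KdV : forall J K mu k F, open J -> open K ->
  smooth2 J K k -> lax_frame J K mu k F -> KdV_solution J K k.
Proof.
  intros J K mu k F oJ oK Sk [SF dF Fs Ft]. split; [exact Sk |].
  intros s t Js Kt.
  change (dt k s t + ds (ds (ds k)) s t - 6 * k s t * ds k s t = 0).
  pose proof (smooth2_ds _ _ _ Sk) as Sk1. pose proof (smooth2_ds _ _ _ Sk1) as Sk2.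
  pose proof (smooth2_is_derive_s _ _ _ s t Sk Js Kt) as D0.
  pose proof (smooth2_is_derive_s _ _ _ s t Sk1 Js Kt) as D1.
  pose proof (smooth2_is_derive_s _ _ _ s t Sk2 Js Kt) as D2.
  pose proof (smooth2_is_derive_t _ _ _ s t Sk Js Kt) as Dt.
  destruct (zero_curvature J K F (fun s t => k s t + mu)
    (fun s t => - ds k s t)
    (fun s t => - ds (ds k) s t + (k s t + mu) * (2 * k s t - 4 * mu))
    (fun s t => 2 * k s t - 4 * mu) s t
    (dt k s t) (- ds (ds k) s t)
    (- ds (ds (ds k)) s t + (ds k s t * (2 * k s t - 4 * mu) + (k s t + mu) * (2 * ds k s t)))
    (2 * ds k s t) oJ oK SF dF) as (_ & _ & E); trivial.
  - intros u v Ju Kv. rewrite Ropp_involutive. now apply Ft.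
  - auto_derive; [eexists; exact Dt | change (1 * dt k s t = dt k s t); ring].
  - now apply (is_derive_opp (fun u => ds k u t)).
  - auto_derive.
    + repeat split; eexists; eassumption.
    + change (Derive (fun x => k x t) s) with (ds k s t).
      change (Derive (fun x => ds (ds k) x t) s) with (ds (ds (ds k)) s t). ring.
  - auto_derive; [eexists; exact D0 | change (2 * (1 * ds k s t) = 2 * ds k s t); ring].
  - lra.
Qed.

Lemma msmooth2_mul : forall J K F G, open J -> open K ->
  msmooth2 J K F -> msmooth2 J K G -> msmooth2 J K (fun s t => mul (F s t) (G s t)).
Proof.
  intros J K F G oJ oK HF HG i j Hi Hj.
  apply (smooth2_ext J K (fun s t => coef (F s t) i 0 * coef (G s t) 0 j
                                   + coef (F s t) i 1 * coef (G s t) 1 j)); trivial.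
  - intros s t _ _. now rewrite coef_mul.
  - apply smooth2_plus; trivial; apply smooth2_mult; trivial;
      first [apply HF | apply HG]; lia.
Qed.

Lemma msmooth2_entries : forall J K a b c d,
  smooth2 J K a -> smooth2 J K b -> smooth2 J K c -> smooth2 J K d ->
  msmooth2 J K (fun s t => mat2 (a s t) (b s t) (c s t) (d s t)).
Proof.
  intros J K a b c d Ha Hb Hc Hd i j Hi Hj.
  destruct i as [|[|i]]; [| | lia]; destruct j as [|[|j]]; solve [assumption | lia].
Qed.

Lemma msmooth2_adj2 : forall J K F, open J -> open K ->
  msmooth2 J K F -> msmooth2 J K (fun s t => adj2 (F s t)).
Proof.
  intros J K F oJ oK HF. apply msmooth2_entries;
    try apply smooth2_opp; trivial; apply HF; lia.
Qed.

Lemma msmooth2_ext : forall J K F G, open J -> open K ->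
  (forall s t, J s -> K t -> F s t = G s t) -> msmooth2 J K F -> msmooth2 J K G.
Proof.
  intros J K F G oJ oK E HF i j Hi Hj.
  apply (smooth2_ext J K (fun s t => coef (F s t) i j)); trivial.
  - intros s t Js Kt. now rewrite E.
  - now apply HF.
Qed.

Lemma msmooth2_curve_at : forall J K F t, open J -> K t -> msmooth2 J K F ->
  msmooth1 J (curve_at F t).
Proof.
  intros J K F t oJ Kt HF i j Hi Hj.
  apply (smooth2_slice J K (fun s t => coef (F s t) i j)); trivial. now apply HF.
Qed.

Lemma lax_moving_frame : forall J K k Fp Fm t, K t ->
  lax_frame J K 1 k Fp -> lax_frame J K (-1) k Fm ->
  moving_frame J (fun s => k s t) (curve_at Fp t) (curve_at Fm t).
Proof.
  intros J K k Fp Fm t Kt [_ dp sp _] [_ dm sm _]. unfold curve_at.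
  split; intros s Js; auto.
Qed.

(** The derivatives of [k] cancel in the difference of the matrices [lax_t] for
    [mu = 1] and [mu = -1], which governs the velocity of [Fp (adj2 Fm)]; what is
    left is the velocity prescribed by the flow. *)
Lemma lax_frames_LIEN : forall J K k Fp Fm g, open J -> open K ->
  lax_frame J K 1 k Fp -> lax_frame J K (-1) k Fm ->
  (forall s t, J s -> K t -> g s t = mul (Fp s t) (adj2 (Fm s t))) ->
  LIEN_solution J K g /\ spinor_frame_field J K g Fp Fm /\
  (forall s t, J s -> K t -> flow_bending g s t = k s t).
Proof.
  intros J K k Fp Fm g oJ oK Hp Hm Hg.
  assert (Sg : msmooth2 J K g).
  { apply (msmooth2_ext J K (fun s t => mul (Fp s t) (adj2 (Fm s t)))); trivial.
    - intros s t Js Kt. now rewrite Hg.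
    - apply msmooth2_mul; trivial; [apply Hp | apply msmooth2_adj2; trivial; apply Hm]. }
  assert (Hc : forall t, K t -> null_curve J (curve_at g t) /\
                 forall s, J s -> flow_bending g s t = k s t).
  { intros t Kt.
    apply (moving_frame_null_curve J (fun s => k s t) (curve_at Fp t) (curve_at Fm t)); trivial.
    - now apply (lax_moving_frame J K).
    - intros s Js. now apply Hg.
    - now apply (msmooth2_curve_at J K). }
  assert (Hk : forall s t, J s -> K t -> flow_bending g s t = k s t).
  { intros s t Js Kt. now apply Hc. }
  split; [split | split; [split |]]; trivial.
  - intros t Kt. now apply Hc.
  - intros s t Js Kt. rewrite Hk by trivial.
    destruct (moving_frame_mDerive J (fun s => k s t) (curve_at Fp t) (curve_at Fm t)
      (curve_at g t) s oJ (lax_moving_frame J K k Fp Fm t Kt Hp Hm)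
      (fun u Ju => Hg u t Ju Kt) Js) as (-> & _ & ->).
    unfold curve_at.
    pose proof (is_mderive_conj (fun v => Fp s v) (fun v => Fm s v) t
      (lax_t (k s t) (ds k s t) (ds (ds k) s t) 1)
      (lax_t (k s t) (ds k s t) (ds (ds k) s t) (-1)) I2) as D.
    apply (mDerive_n_S K (fun v => g s v) (fun v => mul (mul (Fp s v) I2) (adj2 (Fm s v)))); trivial.
    { intros v Kv. rewrite mul_1_r, <- Hg by trivial. apply M2_ext.
      intros i j Hi Hj. now rewrite coef_mDerive_n. }
    match goal with |- is_mderive _ _ ?B =>
      match type of D with _ -> _ -> _ -> is_mderive _ _ ?A => replace B with A end end.
    + apply D; [| now apply (lf_t J K 1 k Fp) | now apply (lf_t J K (-1) k Fm)].
      unfold lax_t. now rewrite coef_mat2_00, coef_mat2_11, Ropp_involutive.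
    + clear. generalize (Fp s t) (Fm s t). intros X Y. unfold lax_t. entries. f_equal; ring.
  - apply Hp.
  - apply Hm.
  - intros t Kt. split.
    + apply (msmooth2_curve_at J K); trivial. apply Hp.
    + apply (msmooth2_curve_at J K); trivial. apply Hm.
    + intros s Js. now apply (lf_SL J K 1 k Fp).
    + intros s Js. now apply (lf_SL J K (-1) k Fm).
    + intros s Js. unfold curve_at. rewrite inv2_SL by now apply (lf_SL J K (-1) k Fm). now apply Hg.
    + intros s Js. change (bending (curve_at g t) s) with (flow_bending g s t).
      rewrite Hk by trivial. apply (is_mderive_unique (curve_at Fp t) s).
      * apply (is_mderive_mDerive J); trivial. apply (msmooth2_curve_at J K); trivial. apply Hp.
      * now apply (lf_s J K 1 k Fp).
    + intros s Js. change (bending (curve_at g t) s) with (flow_bending g s t).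
      rewrite Hk by trivial. apply (is_mderive_unique (curve_at Fm t) s).
      * apply (is_mderive_mDerive J); trivial. apply (msmooth2_curve_at J K); trivial. apply Hm.
      * now apply (lf_s J K (-1) k Fm).
Qed.

Lemma flow_bending_smooth : forall J K g, open J -> open K ->
  msmooth2 J K g -> smooth2 J K (flow_bending g).
Proof.
  intros J K g oJ oK Sg.
  set (d3 := fun i j => ds (ds (ds (fun s t => coef (g s t) i j)))).
  assert (Sd : forall i j, (i < 2)%nat -> (j < 2)%nat -> smooth2 J K (d3 i j)).
  { intros i j Hi Hj. unfold d3. do 3 apply smooth2_ds. now apply Sg. }
  apply (smooth2_ext J K (fun s t => (1 / 16) *
    (d3 0%nat 0%nat s t * d3 1%nat 1%nat s t - d3 0%nat 1%nat s t * d3 1%nat 0%nat s t)));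
    trivial.
  - intros s t _ _. unfold flow_bending, bending. rewrite inner_self.
    change (det2 (mDerive_n (curve_at g t) 3 s)) with
      (d3 0%nat 0%nat s t * d3 1%nat 1%nat s t - d3 0%nat 1%nat s t * d3 1%nat 0%nat s t).
    ring.
  - apply smooth2_mult; trivial; [apply smooth2_const |].
    apply smooth2_minus; trivial; apply smooth2_mult; trivial; apply Sd; lia.
Qed.

(** A frame moving in [SL(2)] has [F_t = F A] with [A = (adj2 F) F_t]
    traceless, because [det2 F] is constant. *)
Lemma SL_velocity : forall J K F, open J -> open K -> msmooth2 J K F ->
  (forall s t, J s -> K t -> det2 (F s t) = 1) ->
  exists a b c, smooth2 J K a /\ smooth2 J K b /\ smooth2 J K c /\
    forall s t, J s -> K t -> is_mderive (fun v => F s v) t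
      (mul (F s t) (mat2 (a s t) (b s t) (c s t) (- a s t))).
Proof.
  intros J K F oJ oK SF dF.
  set (Ft := fun s t => mat2 (dt (fun s t => coef (F s t) 0 0) s t)
    (dt (fun s t => coef (F s t) 0 1) s t) (dt (fun s t => coef (F s t) 1 0) s t)
    (dt (fun s t => coef (F s t) 1 1) s t)).
  assert (DF : forall s t, J s -> K t -> is_mderive (fun v => F s v) t (Ft s t)).
  { intros s t Js Kt i j Hi Hj.
    destruct i as [|[|i]]; [| | lia]; (destruct j as [|[|j]]; [| | lia]);
    match goal with |- is_derive (fun u => coef (F s u) ?i ?j) _ _ =>
      apply (smooth2_is_derive_t J K (fun s t => coef (F s t) i j)) end;
      trivial; now apply SF. }
  set (A := fun s t => mul (adj2 (F s t)) (Ft s t)).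
  assert (SA : msmooth2 J K A).
  { apply msmooth2_mul; trivial; [now apply msmooth2_adj2 |].
    apply msmooth2_entries; apply smooth2_dt; apply SF; lia. }
  exists (fun s t => coef (A s t) 0 0), (fun s t => coef (A s t) 0 1),
    (fun s t => coef (A s t) 1 0).
  split; [apply SA; lia | split; [apply SA; lia | split; [apply SA; lia |]]].
  intros s t Js Kt.
  assert (T : coef (A s t) 1 1 = - coef (A s t) 0 0).
  { (* [F (adj2 F)] is constant, and its derivative is [F_t (adj2 F) + F (adj2 F_t)],
       a scalar matrix with the trace of [A] on the diagonal. *)
    pose proof (is_mderive_mul _ _ _ _ _ (DF s t Js Kt)
                  (is_mderive_adj2 _ _ _ (DF s t Js Kt))) as D1.
    pose proof (is_mderive_ext_on K (fun _ => I2) (fun v => mul (F s v) (adj2 (F s v))) t _ oK Kt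
      (fun v Kv => eq_sym (mul_adj_r _ (dF s v Js Kv))) (is_mderive_const I2 t)) as D2.
    pose proof (is_mderive_unique _ _ _ _ D1 D2) as E. unfold A. cbv beta in E. clear - E.
    revert E. generalize (F s t) (Ft s t). intros X Y E. entries.
    apply mat2_inj in E. destruct E as (E & _). lra. }
  rewrite <- T, <- mat2_coef. unfold A. rewrite mul_assoc, mul_adj_r, mul_1_l by auto.
  now apply DF.
Qed.

(** The spinor frame of a moving null curve is carried by [lax_t].  Write
    [F_t = F A] for both frames.  The flow fixes the difference of the two [A],
    since [g_t = Fp (Ap - Am) (adj2 Fm)]; the first entry of the two zero
    curvature equations then fixes the sum of their lower left entries, and the
    other entries follow by differentiation. *)
Lemma LIEN_lax_frames : forall J K g Fp Fm, open J -> open K ->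
  LIEN_solution J K g -> spinor_frame_field J K g Fp Fm ->
  smooth2 J K (flow_bending g) /\
  lax_frame J K 1 (flow_bending g) Fp /\ lax_frame J K (-1) (flow_bending g) Fm /\
  (forall s t, J s -> K t -> g s t = mul (Fp s t) (adj2 (Fm s t))).
Proof.
  intros J K g Fp Fm oJ oK [Sg _ Eg] [SFp SFm HF].
  pose proof (flow_bending_smooth J K g oJ oK Sg) as Sk.
  set (k := flow_bending g) in *.
  assert (MF : forall t, K t ->
    moving_frame J (fun s => k s t) (curve_at Fp t) (curve_at Fm t) /\
    forall s, J s -> curve_at g t s = mul (curve_at Fp t s) (adj2 (curve_at Fm t s))).
  { intros t Kt. now apply spinor_moving_frame, HF. }
  assert (dFp : forall s t, J s -> K t -> det2 (Fp s t) = 1).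
  { intros s t Js Kt. now apply (mf_SL_p J _ _ _ (proj1 (MF t Kt))). }
  assert (dFm : forall s t, J s -> K t -> det2 (Fm s t) = 1).
  { intros s t Js Kt. now apply (mf_SL_m J _ _ _ (proj1 (MF t Kt))). }
  assert (Hg : forall s t, J s -> K t -> g s t = mul (Fp s t) (adj2 (Fm s t))).
  { intros s t Js Kt. exact (proj2 (MF t Kt) s Js). }
  assert (Fps : forall s t, J s -> K t ->
    is_mderive (fun u => Fp u t) s (mul (Fp s t) (lax_s (k s t + 1)))).
  { intros s t Js Kt. exact (mf_p J _ _ _ (proj1 (MF t Kt)) s Js). }
  assert (Fms : forall s t, J s -> K t ->
    is_mderive (fun u => Fm u t) s (mul (Fm s t) (lax_s (k s t + -1)))).
  { intros s t Js Kt. exact (mf_m J _ _ _ (proj1 (MF t Kt)) s Js). }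
  destruct (SL_velocity J K Fp oJ oK SFp dFp) as (ap & bp & cp & Sap & Sbp & Scp & Fpt).
  destruct (SL_velocity J K Fm oJ oK SFm dFm) as (am & bm & cm & Sam & Sbm & Scm & Fmt).
  assert (Dif : forall s t, J s -> K t ->
    ap s t = am s t /\ bp s t - bm s t = - 4 * k s t /\ cp s t - cm s t = -8).
  { intros s t Js Kt.
    pose proof (is_mderive_conj (fun v => Fp s v) (fun v => Fm s v) t
      (mat2 (ap s t) (bp s t) (cp s t) (- ap s t))
      (mat2 (am s t) (bm s t) (cm s t) (- am s t)) I2 eq_refl
      (Fpt s t Js Kt) (Fmt s t Js Kt)) as D.
    assert (E : mDerive_n (fun v => g s v) 1 t =
      mul (mul (Fp s t) (mat2 (ap s t - am s t) (bp s t - bm s t) (cp s t - cm s t)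
            (- ap s t + am s t))) (adj2 (Fm s t))).
    { apply (mDerive_n_S K (fun v => g s v)
               (fun v => mul (mul (Fp s v) I2) (adj2 (Fm s v)))); trivial.
      - intros v Kv. rewrite mul_1_r, <- Hg by trivial. apply M2_ext.
        intros i j Hi Hj. now rewrite coef_mDerive_n.
      - match type of D with is_mderive _ _ (mul (mul _ ?A) _) =>
          match goal with |- is_mderive _ _ (mul (mul _ ?B) _) => replace B with A end end.
        + exact D.
        + clear. entries. f_equal; ring. }
    rewrite Eg in E by trivial. fold k in E.
    destruct (moving_frame_mDerive J (fun s => k s t) (curve_at Fp t) (curve_at Fm t)
      (curve_at g t) s oJ (proj1 (MF t Kt)) (proj2 (MF t Kt)) Js) as (E1 & _ & E3).
    rewrite E1, E3 in E. unfold curve_at in E.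
    assert (E' : mul (mul (Fp s t) (mat2 0 (- 4 * k s t) (-8) 0)) (adj2 (Fm s t)) =
      mul (mul (Fp s t) (mat2 (ap s t - am s t) (bp s t - bm s t) (cp s t - cm s t)
            (- ap s t + am s t))) (adj2 (Fm s t))).
    { rewrite <- E. generalize (Fp s t) (Fm s t). clear. intros X Y. entries. f_equal; ring. }
    apply mul_cancel_r in E'; [| rewrite det2_adj2; auto].
    apply mul_cancel_l in E'; [| auto].
    apply mat2_inj in E'. destruct E' as (E1' & E2' & E3' & _). lra. }
  assert (Curv : forall s t, J s -> K t ->
    (ds ap s t = bp s t - (k s t + 1) * cp s t /\ ds cp s t = - 2 * ap s t) /\
    (ds am s t = bm s t - (k s t + -1) * cm s t)).
  { intros s t Js Kt.
    assert (Dq : forall mu, is_derive (fun v => k s v + mu) t (dt k s t)).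
    { intros mu. pose proof (smooth2_is_derive_t J K k s t Sk Js Kt) as D.
      auto_derive; [eexists; exact D | change (1 * dt k s t = dt k s t); ring]. }
    destruct (zero_curvature J K Fp (fun s t => k s t + 1) ap bp cp s t
      (dt k s t) (ds ap s t) (ds bp s t) (ds cp s t)) as (P1 & P2 & _); trivial;
      try now apply (smooth2_is_derive_s J K).
    destruct (zero_curvature J K Fm (fun s t => k s t + -1) am bm cm s t
      (dt k s t) (ds am s t) (ds bm s t) (ds cm s t)) as (M1 & _); trivial;
      try now apply (smooth2_is_derive_s J K).
    now repeat split. }
  assert (Dam : forall s t, J s -> K t -> ds ap s t = ds am s t).
  { intros s t Js Kt. apply Derive_ext_loc. apply (open_near J); trivial.
    intros u Ju. now apply Dif. }
  assert (Ecp : forall s t, J s -> K t -> cp s t = 2 * k s t - 4).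
  { intros s t Js Kt. destruct (Dif s t Js Kt) as (E1 & E2 & E3).
    destruct (Curv s t Js Kt) as ((C1 & _) & C2). pose proof (Dam s t Js Kt).
    replace (cm s t) with (cp s t + 8) in * by lra.
    replace (bm s t) with (bp s t + 4 * k s t) in * by lra. lra. }
  assert (Eap : forall s t, J s -> K t -> ap s t = - ds k s t).
  { intros s t Js Kt. destruct (Curv s t Js Kt) as ((_ & C) & _).
    assert (D : ds cp s t = 2 * ds k s t).
    { unfold ds. rewrite (Derive_ext_loc (fun u => cp u t) (fun u => 2 * k u t - 4)).
      - apply is_derive_unique. pose proof (smooth2_is_derive_s J K k s t Sk Js Kt) as D.
        auto_derive; [eexists; exact D | change (2 * (1 * ds k s t) = 2 * ds k s t); ring].
      - apply (open_near J); trivial. intros u Ju. now apply Ecp. }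
    lra. }
  assert (Dap : forall s t, J s -> K t -> ds ap s t = - ds (ds k) s t).
  { intros s t Js Kt. unfold ds at 1.
    rewrite (Derive_ext_loc (fun u => ap u t) (fun u => - ds k u t)).
    - rewrite Derive_opp. reflexivity.
    - apply (open_near J); trivial. intros u Ju. now apply Eap. }
  assert (Ebp : forall s t, J s -> K t ->
    bp s t = - ds (ds k) s t + (k s t + 1) * (2 * k s t - 4)).
  { intros s t Js Kt. destruct (Curv s t Js Kt) as ((C & _) & _).
    rewrite Dap, Ecp in C by trivial. lra. }
  split; [exact Sk | split; [| split; [| exact Hg]]]; split; trivial.
  - intros s t Js Kt. unfold lax_t.
    replace (mat2 _ _ _ _) with (mat2 (ap s t) (bp s t) (cp s t) (- ap s t)); [now apply Fpt |].
    rewrite Eap, Ebp, Ecp by trivial. f_equal; ring.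
  - intros s t Js Kt. unfold lax_t. destruct (Dif s t Js Kt) as (E1 & E2 & E3).
    replace (mat2 _ _ _ _) with (mat2 (am s t) (bm s t) (cm s t) (- am s t)); [now apply Fmt |].
    rewrite Eap in E1 by trivial. rewrite Ebp in E2 by trivial. rewrite Ecp in E3 by trivial.
    f_equal; lra.
Qed.

(** * The Wahlquist-Estabrook equation *)

Definition we_t (k k1 k2 lam f : R) : R :=
  4 * lam * (f ^ 2 - lam) - 2 * k * (f ^ 2 + lam) + 2 * k ^ 2 + 2 * f * k1 - k2.

Lemma WE_is_derive : forall J K k lam f s t, WE_solution J K k lam f -> J s -> K t ->
  is_derive (fun u => f u t) s (k s t - f s t ^ 2 + lam) /\
  is_derive (fun v => f s v) t (we_t (k s t) (ds k s t) (ds (ds k) s t) lam (f s t)).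
Proof. intros J K k lam f s t H Js Kt. apply differentiable_is_derive. now apply H. Qed.

(** The equation expresses the partial derivatives of [f] as polynomials in [f]
    itself and in smooth functions, so regularity bootstraps from continuity. *)
Lemma WE_smooth : forall J K k lam f, open J -> open K ->
  smooth2 J K k -> WE_solution J K k lam f -> smooth2 J K f.
Proof.
  intros J K k lam f oJ oK Sk H n. change (Cn J K n f).
  assert (cf : forall s t, J s -> K t -> continuity_2d_pt f s t).
  { intros s t Js Kt. apply differentiable_continuity_pt. eexists. eexists. now apply H. }
  induction n as [|n IH]; [intros s t Js Kt; split; [now apply cf | trivial] |].
  pose proof (Sk n : Cn J K n k) as C0.
  pose proof (smooth2_ds _ _ _ Sk n : Cn J K n (ds k)) as C1.
  pose proof (smooth2_ds _ _ _ (smooth2_ds _ _ _ Sk) n : Cn J K n (ds (ds k))) as C2.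
  apply (Cn_S_intro J K n f
    (fun s t => k s t + (-1) * (f s t * f s t) + lam)
    (fun s t => 4 * lam * (f s t * f s t + - lam) + (-2) * (k s t * (f s t * f s t + lam))
       + 2 * (k s t * k s t) + 2 * (f s t * ds k s t) + (-1) * ds (ds k) s t)); trivial.
  - intros s t Js Kt. evar_last; [now apply (WE_is_derive J K k lam f s t) | ring].
  - intros s t Js Kt. evar_last; [now apply (WE_is_derive J K k lam f s t) |].
    unfold we_t. ring.
  - repeat first [assumption | apply Cn_plus | apply Cn_mult | apply Cn_const].
  - repeat first [assumption | apply Cn_plus | apply Cn_mult | apply Cn_const].
Qed.

Lemma WE_ext : forall J K k k' lam f f', open J -> open K ->
  (forall s t, J s -> K t -> k s t = k' s t) ->
  (forall s t, J s -> K t -> f s t = f' s t) ->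
  WE_solution J K k lam f -> WE_solution J K k' lam f'.
Proof.
  intros J K k k' lam f f' oJ oK Ek Ef H s t Js Kt.
  assert (E1 : forall u, J u -> ds k u t = ds k' u t).
  { intros u Ju. apply Derive_ext_loc. apply (open_near J); trivial. auto. }
  assert (E2 : ds (ds k) s t = ds (ds k') s t).
  { apply Derive_ext_loc. now apply (open_near J). }
  change (Derive (fun u => k' u t) s) with (ds k' s t).
  change (Derive_n (fun u => k' u t) 2 s) with (ds (ds k') s t).
  rewrite <- E2, <- E1, <- Ek, <- Ef by trivial.
  apply (differentiable_pt_lim_ext f); [now apply (open_near_2d J K) | now apply H].
Qed.

Definition transformed_bending (lam : R) (k f : R -> R -> R) : R -> R -> R :=
  fun s t => 2 * f s t ^ 2 - 2 * lam - k s t.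

Lemma transformed_bending_ds : forall J K k lam f s t, open J -> open K ->
  smooth2 J K k -> WE_solution J K k lam f -> J s -> K t ->
  ds (transformed_bending lam k f) s t
    = 4 * f s t * (k s t - f s t ^ 2 + lam) - ds k s t /\
  ds (ds (transformed_bending lam k f)) s t
    = 4 * (k s t - f s t ^ 2 + lam) ^ 2
      + 4 * f s t * (ds k s t - 2 * f s t * (k s t - f s t ^ 2 + lam)) - ds (ds k) s t.
Proof.
  intros J K k lam f s t oJ oK Sk H Js Kt.
  assert (D1 : forall u, J u -> ds (transformed_bending lam k f) u t
                 = 4 * f u t * (k u t - f u t ^ 2 + lam) - ds k u t).
  { intros u Ju. apply is_derive_unique. unfold transformed_bending.
    destruct (WE_is_derive J K k lam f u t H Ju Kt) as [Df _].
    pose proof (smooth2_is_derive_s J K k u t Sk Ju Kt) as Dk.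
    auto_derive; [repeat split; eexists; eassumption |].
    rewrite (Derive_val (fun x => f x t) u _ Df), (Derive_val (fun x => k x t) u _ Dk).
    ring. }
  split; [now apply D1 |].
  unfold ds at 1. rewrite (Derive_ext_loc _ (fun u => 4 * f u t * (k u t - f u t ^ 2 + lam) - ds k u t)).
  2: { now apply (open_near J). }
  apply is_derive_unique.
  destruct (WE_is_derive J K k lam f s t H Js Kt) as [Df _].
  pose proof (smooth2_is_derive_s J K k s t Sk Js Kt) as Dk.
  pose proof (smooth2_is_derive_s J K (ds k) s t (smooth2_ds _ _ _ Sk) Js Kt) as Dk1.
  auto_derive; [repeat split; eexists; eassumption |].
  rewrite (Derive_val (fun x => f x t) s _ Df), (Derive_val (fun x => k x t) s _ Dk),
    (Derive_val (fun x => ds k x t) s _ Dk1).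
  ring.
Qed.

(** With the first derivatives of [f1] and [f2] and the first two derivatives in
    [s] of the transformed bending expressed through [f1], [f2], [k] and the
    derivatives of [k], both components of the equation become rational
    identities in these quantities. *)
Lemma WE_permuted : forall J K k lam1 lam2 f1 f2 h, open J -> open K ->
  smooth2 J K k -> WE_solution J K k lam1 f1 -> WE_solution J K k lam2 f2 ->
  (forall s t, J s -> K t -> f1 s t <> f2 s t) ->
  (forall s t, J s -> K t -> h s t = - f1 s t + (lam1 - lam2) / (f1 s t - f2 s t)) ->
  WE_solution J K (transformed_bending lam1 k f1) lam2 h.
Proof.
  intros J K k lam1 lam2 f1 f2 h oJ oK Sk H1 H2 ne Eh.
  assert (nz : forall s t, J s -> K t -> f1 s t - f2 s t <> 0).
  { intros s t Js Kt. apply Rminus_eq_contra. now apply ne. }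
  set (f21 := fun s t => - f1 s t + (lam1 - lam2) / (f1 s t - f2 s t)).
  apply (WE_ext J K (transformed_bending lam1 k f1) _ lam2 f21); trivial.
  { intros s t Js Kt. unfold f21. now rewrite Eh. }
  pose proof (WE_smooth J K k lam1 f1 oJ oK Sk H1) as S1.
  pose proof (WE_smooth J K k lam2 f2 oJ oK Sk H2) as S2.
  assert (S21 : smooth2 J K f21).
  { unfold f21, Rdiv. smooth2. }
  intros s t Js Kt.
  change (Derive (fun u => transformed_bending lam1 k f1 u t) s)
    with (ds (transformed_bending lam1 k f1) s t).
  change (Derive_n (fun u => transformed_bending lam1 k f1 u t) 2 s)
    with (ds (ds (transformed_bending lam1 k f1)) s t).
  destruct (transformed_bending_ds J K k lam1 f1 s t oJ oK Sk H1 Js Kt) as [-> ->].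
  destruct (WE_is_derive J K k lam1 f1 s t H1 Js Kt) as [D1s D1t].
  destruct (WE_is_derive J K k lam2 f2 s t H2 Js Kt) as [D2s D2t].
  pose proof (nz s t Js Kt) as N.
  apply (smooth2_differentiable J K); trivial.
  - unfold f21. auto_derive; [repeat split; trivial; eexists; eassumption |].
    rewrite (Derive_val (fun x => f1 x t) s _ D1s), (Derive_val (fun x => f2 x t) s _ D2s).
    unfold transformed_bending. field. exact N.
  - unfold f21. auto_derive; [repeat split; trivial; eexists; eassumption |].
    rewrite (Derive_val (fun x => f1 s x) t _ D1t), (Derive_val (fun x => f2 s x) t _ D2t).
    unfold transformed_bending, we_t. field. exact N.
Qed.

(** * Darboux matrices *)

(** In terms of the rows [(y, y')] of a frame, solutions of [y'' = (k + mu) y],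
    this is the classical Darboux transformation [y -> y' - f y], where [f] is
    the logarithmic derivative of a solution for [lam] in place of [mu]. *)
Definition darboux (lam mu f : R) : M2 := mat2 (- f) (mu - lam + f ^ 2) 1 (- f).

Lemma det2_darboux : forall lam mu f, det2 (darboux lam mu f) = lam - mu.
Proof. intros. unfold darboux. rewrite det2_mat2. ring. Qed.

Definition darboux_frame (c lam mu : R) (f : R -> R -> R) (F : R -> R -> M2) : R -> R -> M2 :=
  fun s t => mscal c (mul (F s t) (darboux lam mu (f s t))).

(** The Darboux matrix [D] is a gauge transformation of the Lax pair: the two
    equations to check are [L D + D_s = D L'] and [A D + D_t = D A'], where
    primes refer to the transformed bending. *)
Lemma darboux_lax_frame : forall J K mu k F c lam f, open J -> open K ->
  smooth2 J K k -> WE_solution J K k lam f -> c * c * (lam - mu) = 1 ->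
  lax_frame J K mu k F ->
  lax_frame J K mu (transformed_bending lam k f) (darboux_frame c lam mu f F).
Proof.
  intros J K mu k F c lam f oJ oK Sk H Hc [SF dF Fs Ft].
  pose proof (WE_smooth J K k lam f oJ oK Sk H) as Sf.
  assert (Dar : forall (x : R -> R) u x', is_derive x u x' ->
    is_mderive (fun v => darboux lam mu (x v)) u (mat2 (- x') (2 * x u * x') 0 (- x'))).
  { intros x u x' Dx. apply is_mderive_entries.
    - now apply (is_derive_opp x).
    - auto_derive; [eexists; exact Dx | rewrite (Derive_val (fun v => x v) u _ Dx); ring].
    - exact (is_derive_const _ _).
    - now apply (is_derive_opp x). }
  assert (Prod : forall (G : R -> M2) (x : R -> R) u x' A B, is_derive x u x' ->
    is_mderive G u (mul (G u) A) ->
    madd (mul A (darboux lam mu (x u))) (mat2 (- x') (2 * x u * x') 0 (- x'))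
      = mul (darboux lam mu (x u)) B ->
    is_mderive (fun v => mscal c (mul (G v) (darboux lam mu (x v)))) u
      (mul (mscal c (mul (G u) (darboux lam mu (x u)))) B)).
  { intros G x u x' A B Dx DG E.
    replace (mul (mscal c _) B) with (mscal c (madd (mul (mul (G u) A) (darboux lam mu (x u)))
      (mul (G u) (mat2 (- x') (2 * x u * x') 0 (- x'))))).
    - apply is_mderive_mscal. apply (is_mderive_mul G (fun v => darboux lam mu (x v))); auto.
    - transitivity (mscal c (mul (G u) (mul (darboux lam mu (x u)) B))).
      + rewrite <- E. generalize (G u) (darboux lam mu (x u)) (mat2 (- x') (2 * x u * x') 0 (- x')).
        clear. intros X Y Z. entries. f_equal; ring.
      + generalize (G u) (darboux lam mu (x u)). clear. intros X Y. entries. f_equal; ring. }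
  split.
  - intros i j Hi Hj.
    apply (smooth2_ext J K (fun s t => c * coef (mul (F s t) (darboux lam mu (f s t))) i j)); trivial.
    { intros s t _ _. unfold darboux_frame. now rewrite coef_mscal. }
    apply smooth2_mult; trivial; [apply smooth2_const |].
    apply (msmooth2_mul J K F (fun s t => darboux lam mu (f s t))); trivial.
    apply msmooth2_entries; smooth2.
  - intros s t Js Kt. unfold darboux_frame.
    rewrite det2_mscal, det2_mul, det2_darboux, dF, Rmult_1_l by trivial. exact Hc.
  - intros s t Js Kt. destruct (WE_is_derive J K k lam f s t H Js Kt) as [Ds _].
    apply (Prod (fun u => F u t) (fun u => f u t) s _ _ _ Ds (Fs s t Js Kt)).
    unfold darboux, lax_s, transformed_bending. entries. f_equal; ring.
  - intros s t Js Kt. destruct (WE_is_derive J K k lam f s t H Js Kt) as [_ Dt].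
    apply (Prod (fun v => F s v) (fun v => f s v) t _ _ _ Dt (Ft s t Js Kt)).
    destruct (transformed_bending_ds J K k lam f s t oJ oK Sk H Js Kt) as [-> ->].
    unfold darboux, lax_t, transformed_bending, we_t. entries. f_equal; ring.
Qed.

(** Bianchi permutability.  Both products are affine in [mu] with the same leading
    coefficient, and have the same left kernels at the two values [mu = lam1]
    and [mu = lam2] where they degenerate; the formula for the permuted functions
    is what makes this happen. *)
Lemma darboux_permutability : forall lam1 lam2 mu f1 f2, f1 <> f2 ->
  mul (darboux lam1 mu f1) (darboux lam2 mu (- f1 + (lam1 - lam2) / (f1 - f2))) =
  mul (darboux lam2 mu f2) (darboux lam1 mu (- f2 + (lam1 - lam2) / (f1 - f2))).
Proof.
  intros lam1 lam2 mu f1 f2 ne. apply Rminus_eq_contra in ne.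
  unfold darboux. entries. f_equal; field; exact ne.
Qed.

(** * Transforms of flows *)

Lemma cosh_double_minus_1 : forall x, cosh (2 * x) - 1 = 2 * (sinh x * sinh x).
Proof.
  intros x. unfold cosh, sinh.
  replace (2 * x) with (x + x) by ring. rewrite Ropp_plus_distr, !exp_plus.
  assert (E : exp x * exp (- x) = 1) by (rewrite <- exp_plus, Rplus_opp_r; apply exp_0).
  lra.
Qed.

Lemma cosh_double_plus_1 : forall x, cosh (2 * x) + 1 = 2 * (cosh x * cosh x).
Proof.
  intros x. unfold cosh, sinh.
  replace (2 * x) with (x + x) by ring. rewrite Ropp_plus_distr, !exp_plus.
  assert (E : exp x * exp (- x) = 1) by (rewrite <- exp_plus, Rplus_opp_r; apply exp_0).
  lra.
Qed.

Lemma cosh_neq_0 : forall x, cosh x <> 0.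
Proof.
  intros x. unfold cosh. pose proof (exp_pos x). pose proof (exp_pos (- x)). lra.
Qed.

Lemma sinh_neq_0 : forall x, x <> 0 -> sinh x <> 0.
Proof.
  intros x Hx. unfold sinh. intros E. apply Hx.
  assert (exp x = exp (- x)) as E' by lra. apply exp_inv in E'. lra.
Qed.

(** The factors normalizing [darboux (cosh (2 * xi)) mu f], of determinant
    [cosh (2 * xi) - mu], to determinant 1; the sign of the transform is
    attached to the first frame. *)
Definition norm_p (eps xi : R) : R := eps / (sqrt 2 * sinh xi).
Definition norm_m (xi : R) : R := / (sqrt 2 * cosh xi).

Lemma sqrt2_facts : sqrt 2 <> 0 /\ sqrt 2 * sqrt 2 = 2.
Proof.
  assert (E : sqrt 2 * sqrt 2 = 2) by (apply sqrt_sqrt; lra).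
  split; [| exact E]. intros Z. rewrite Z in E. lra.
Qed.

Lemma norm_p_spec : forall eps xi, eps * eps = 1 -> xi <> 0 ->
  norm_p eps xi * norm_p eps xi * (cosh (2 * xi) - 1) = 1.
Proof.
  intros eps xi He Hx. destruct sqrt2_facts as [s0 s2].
  pose proof (sinh_neq_0 xi Hx).
  rewrite cosh_double_minus_1. unfold norm_p.
  transitivity (eps * eps * (2 / (sqrt 2 * sqrt 2))); [field; auto | rewrite He, s2; field].
Qed.

Lemma norm_m_spec : forall xi, norm_m xi * norm_m xi * (cosh (2 * xi) - -1) = 1.
Proof.
  intros xi. destruct sqrt2_facts as [s0 s2]. pose proof (cosh_neq_0 xi).
  replace (cosh (2 * xi) - -1) with (cosh (2 * xi) + 1) by ring.
  rewrite cosh_double_plus_1. unfold norm_m.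
  transitivity (2 / (sqrt 2 * sqrt 2)); [field; auto | rewrite s2; field].
Qed.

(** The matrix of the transform is the quotient of the two normalized Darboux
    matrices: this is what makes the transform act on frames. *)
Lemma T_matrix_darboux : forall eps xi f, xi <> 0 ->
  mscal eps (T_matrix xi f) =
  mscal (norm_p eps xi * norm_m xi)
    (mul (darboux (cosh (2 * xi)) 1 f) (adj2 (darboux (cosh (2 * xi)) (-1) f))).
Proof.
  intros eps xi f Hx. destruct sqrt2_facts as [s0 s2].
  pose proof (sinh_neq_0 xi Hx) as Hs. pose proof (cosh_neq_0 xi) as Hc.
  assert (En : norm_p eps xi * norm_m xi = eps / (2 * sinh xi * cosh xi)).
  { transitivity (eps / (sqrt 2 * sqrt 2 * sinh xi * cosh xi)); [| now rewrite s2].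
    unfold norm_p, norm_m. field. auto. }
  rewrite En.
  transitivity (mscal (eps / (2 * sinh xi * cosh xi))
    (mat2 (cosh (2 * xi) - 1) (- 2 * f) 0 (cosh (2 * xi) + 1))).
  - rewrite cosh_double_minus_1, cosh_double_plus_1.
    unfold T_matrix, tanh, coth, csch, sech. entries. f_equal; field; auto.
  - unfold darboux. entries. f_equal; ring.
Qed.

(** The frame field in the definition of the transform may be replaced by any
    other: the signs relating the two cancel. *)
Lemma T_transform_formula : forall J K eps xi f g g' Fp Fm s t, open J ->
  T_transform J K eps xi f g g' -> spinor_frame_field J K g Fp Fm -> J s -> K t ->
  g' s t = mscal eps (mul (mul (Fp s t) (T_matrix xi (f s t))) (adj2 (Fm s t))).
Proof.
  intros J K eps xi f g g' Fp Fm s t oJ HT [_ _ HF] Js Kt.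
  destruct (T_formula _ _ _ _ _ _ _ HT) as (Gp & Gm & [_ _ HG] & ->); trivial.
  destruct (spinor_frame_unique J (curve_at g t) (curve_at Gp t) (curve_at Gm t)
    (curve_at Fp t) (curve_at Fm t) s oJ (HG t Kt) (HF t Kt) Js) as (c & Hc & Ep & Em).
  assert (dGm : det2 (Gm s t) = 1) by exact (sf_SL_m _ _ _ _ (HG t Kt) s Js).
  rewrite inv2_SL by trivial. unfold curve_at in Ep, Em. rewrite Ep, Em.
  generalize (Fp s t) (Fm s t) (T_matrix xi (f s t)). intros X Y Z.
  transitivity (mscal (c * c) (mscal eps (mul (mul X Z) (adj2 Y)))); [| rewrite Hc];
    clear; entries; f_equal; ring.
Qed.

(** A transform acts on spinor frames by normalized Darboux matrices, which
    preserve the linear system and change the bending. *)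
Lemma T_transform_frames : forall J K eps xi f g g' Fp Fm, open J -> open K ->
  eps * eps = 1 -> T_transform J K eps xi f g g' -> spinor_frame_field J K g Fp Fm ->
  let lam := cosh (2 * xi) in
  let Gp := darboux_frame (norm_p eps xi) lam 1 f Fp in
  let Gm := darboux_frame (norm_m xi) lam (-1) f Fm in
  LIEN_solution J K g' /\ spinor_frame_field J K g' Gp Gm /\
  (forall s t, J s -> K t ->
     flow_bending g' s t = transformed_bending lam (flow_bending g) f s t) /\
  (forall s t, J s -> K t -> g' s t = mul (Gp s t) (adj2 (Gm s t))).
Proof.
  intros J K eps xi f g g' Fp Fm oJ oK He HT HF lam Gp Gm.
  pose proof (T_lien _ _ _ _ _ _ _ HT) as Hg.
  pose proof (T_param _ _ _ _ _ _ _ HT) as Hxi.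
  pose proof (T_fun _ _ _ _ _ _ _ HT) as Hf. fold lam in Hf.
  destruct (LIEN_lax_frames J K g Fp Fm oJ oK Hg HF) as (Sk & Lp & Lm & _).
  assert (Eg : forall s t, J s -> K t -> g' s t = mul (Gp s t) (adj2 (Gm s t))).
  { intros s t Js Kt. rewrite (T_transform_formula J K eps xi f g g' Fp Fm) by trivial.
    transitivity (mul (mul (Fp s t) (mscal eps (T_matrix xi (f s t)))) (adj2 (Fm s t))).
    - generalize (Fp s t) (Fm s t) (T_matrix xi (f s t)). clear. intros X Y Z.
      entries. f_equal; ring.
    - rewrite T_matrix_darboux by trivial. unfold Gp, Gm, darboux_frame. fold lam.
      generalize (Fp s t) (Fm s t) (darboux lam 1 (f s t)) (darboux lam (-1) (f s t))
        (norm_p eps xi) (norm_m xi).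
      clear. intros X Y Z W c c'. entries. f_equal; ring. }
  pose proof (darboux_lax_frame J K 1 _ Fp (norm_p eps xi) lam f oJ oK Sk Hf
                (norm_p_spec eps xi He Hxi) Lp) as Lp'.
  pose proof (darboux_lax_frame J K (-1) _ Fm (norm_m xi) lam f oJ oK Sk Hf
                (norm_m_spec xi) Lm) as Lm'.
  destruct (lax_frames_LIEN J K _ Gp Gm g' oJ oK Lp' Lm' Eg) as (H1 & H2 & H3).
  exact (conj H1 (conj H2 (conj H3 Eg))).
Qed.

Lemma T_transform_exists : forall J K eps xi f g Fp Fm,
  LIEN_solution J K g -> spinor_frame_field J K g Fp Fm -> xi <> 0 ->
  WE_solution J K (flow_bending g) (cosh (2 * xi)) f ->
  exists g', T_transform J K eps xi f g g'.
Proof.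
  intros J K eps xi f g Fp Fm Hg HF Hx Hf.
  exists (fun s t => mscal eps (mul (mul (Fp s t) (T_matrix xi (f s t))) (inv2 (Fm s t)))).
  split; trivial. exists Fp, Fm. split; trivial.
Qed.

Lemma darboux_frame_permutability : forall c1 c2 lam1 lam2 mu f1 f2 f21 f12 F s t,
  f1 s t <> f2 s t ->
  f21 s t = - f1 s t + (lam1 - lam2) / (f1 s t - f2 s t) ->
  f12 s t = - f2 s t + (lam1 - lam2) / (f1 s t - f2 s t) ->
  darboux_frame c2 lam2 mu f21 (darboux_frame c1 lam1 mu f1 F) s t =
  darboux_frame c1 lam1 mu f12 (darboux_frame c2 lam2 mu f2 F) s t.
Proof.
  intros c1 c2 lam1 lam2 mu f1 f2 f21 f12 F s t ne E21 E12.
  pose proof (darboux_permutability lam1 lam2 mu _ _ ne) as P.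
  rewrite <- E21, <- E12 in P. unfold darboux_frame.
  assert (A : forall c c' X Y Z,
    mscal c (mul (mscal c' (mul X Y)) Z) = mscal (c * c') (mul X (mul Y Z))).
  { clear. intros c c' X Y Z. entries. f_equal; ring. }
  rewrite !A, P, (Rmult_comm c2). reflexivity.
Qed.

Lemma KdV_ext : forall J K k k', open J -> open K ->
  (forall s t, J s -> K t -> k s t = k' s t) -> KdV_solution J K k -> KdV_solution J K k'.
Proof.
  intros J K k k' oJ oK E [Sk H]. split; [now apply (smooth2_ext J K k) |].
  intros s t Js Kt. rewrite <- E by trivial.
  rewrite <- (Derive_ext_loc (fun v => k s v) (fun v => k' s v)) by (now apply (open_near K); auto).
  rewrite <- (Derive_ext_loc (fun u => k u t) (fun u => k' u t)) by (now apply (open_near J); auto).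
  rewrite <- (Derive_n_ext_loc (fun u => k u t) (fun u => k' u t)) by (now apply (open_near J); auto).
  now apply H.
Qed.

Theorem theorem4p6 :
  forall (J K : R -> Prop) (eps xi1 xi2 : R)
    (g g1 g2 : R -> R -> M2) (f1 f2 : R -> R -> R),
  is_open_interval J -> J 0 ->
  is_open_interval K -> K 0 ->
  eps = 1 \/ eps = -1 ->
  T_transform J K eps xi1 f1 g g1 ->
  T_transform J K eps xi2 f2 g g2 ->
  xi1 <> xi2 ->
  (forall s t, J s -> K t -> f1 s t <> f2 s t) ->
  let lam1 := cosh (2 * xi1) in
  let lam2 := cosh (2 * xi2) in
  let k := flow_bending g in
  let k1 := flow_bending g1 in
  let k2 := flow_bending g2 in
  let f21 := fun s t => - f1 s t + (lam1 - lam2) / (f1 s t - f2 s t) in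
  let f12 := fun s t => - f2 s t + (lam1 - lam2) / (f1 s t - f2 s t) in
  let k21 := fun s t =>
    k s t - 2 * (lam1 - lam2) * ((f1 s t + f2 s t) / (f1 s t - f2 s t))
    + 2 * ((lam1 - lam2) / (f1 s t - f2 s t)) ^ 2 in
  WE_solution J K k1 lam2 f21 /\
  WE_solution J K k2 lam1 f12 /\
  (exists g21, T_transform J K eps xi2 f21 g1 g21) /\
  (exists g12, T_transform J K eps xi1 f12 g2 g12) /\
  (forall g21 g12 : R -> R -> M2,
     T_transform J K eps xi2 f21 g1 g21 ->
     T_transform J K eps xi1 f12 g2 g12 ->
     LIEN_solution J K g21 /\
     LIEN_solution J K g12 /\
     (forall s t, J s -> K t -> g21 s t = g12 s t) /\
     (forall s t, J s -> K t -> flow_bending g21 s t = k21 s t) /\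
     (forall s t, J s -> K t -> flow_bending g12 s t = k21 s t)) /\
  KdV_solution J K k21.
Proof.
  intros J K eps xi1 xi2 g g1 g2 f1 f2 iJ _ iK _ Heps T1 T2 _ ne lam1 lam2 k k1 k2 f21 f12 k21.
  pose proof (open_interval_open J iJ) as oJ. pose proof (open_interval_open K iK) as oK.
  assert (He : eps * eps = 1) by (destruct Heps as [-> | ->]; ring).
  assert (nz : forall s t, J s -> K t -> f1 s t - f2 s t <> 0).
  { intros s t Js Kt. apply Rminus_eq_contra. now apply ne. }
  destruct (T_formula _ _ _ _ _ _ _ T1) as (Fp & Fm & HF & _).
  pose proof (T_fun _ _ _ _ _ _ _ T1) as W1. pose proof (T_fun _ _ _ _ _ _ _ T2) as W2.
  fold lam1 in W1. fold lam2 in W2.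
  destruct (LIEN_lax_frames J K g Fp Fm oJ oK (T_lien _ _ _ _ _ _ _ T1) HF) as (Sk & _).
  destruct (T_transform_frames J K eps xi1 f1 g g1 Fp Fm oJ oK He T1 HF)
    as (L1 & HG1 & B1 & _).
  destruct (T_transform_frames J K eps xi2 f2 g g2 Fp Fm oJ oK He T2 HF)
    as (L2 & HG2 & B2 & _).
  fold lam1 in HG1, B1. fold lam2 in HG2, B2. fold k in W1, W2, Sk, B1, B2.
  assert (W21 : WE_solution J K k1 lam2 f21).
  { apply (WE_ext J K (transformed_bending lam1 k f1) _ lam2 f21); trivial.
    - intros s t Js Kt. symmetry. now apply B1.
    - now apply (WE_permuted J K k lam1 lam2 f1 f2). }
  assert (W12 : WE_solution J K k2 lam1 f12).
  { apply (WE_ext J K (transformed_bending lam2 k f2) _ lam1 f12); trivial.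
    - intros s t Js Kt. symmetry. now apply B2.
    - apply (WE_permuted J K k lam2 lam1 f2 f1); trivial.
      + intros s t Js Kt E. now apply (ne s t).
      + intros s t Js Kt. unfold f12. pose proof (nz s t Js Kt). field. lra. }
  destruct (T_transform_exists J K eps xi2 f21 g1 _ _ L1 HG1 (T_param _ _ _ _ _ _ _ T2) W21)
    as (h21 & X21).
  destruct (T_transform_exists J K eps xi1 f12 g2 _ _ L2 HG2 (T_param _ _ _ _ _ _ _ T1) W12)
    as (h12 & X12).
  assert (B21 : forall s t, J s -> K t -> transformed_bending lam2 k1 f21 s t = k21 s t).
  { intros s t Js Kt. unfold transformed_bending at 1. unfold k1. rewrite B1 by trivial.
    unfold transformed_bending, f21, k21. field. now apply nz. }
  assert (B12 : forall s t, J s -> K t -> transformed_bending lam1 k2 f12 s t = k21 s t).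
  { intros s t Js Kt. unfold transformed_bending at 1. unfold k2. rewrite B2 by trivial.
    unfold transformed_bending, f12, k21. field. now apply nz. }
  split; [exact W21 | split; [exact W12 |]].
  split; [now exists h21 | split; [now exists h12 | split]].
  - intros g21 g12 Y21 Y12.
    destruct (T_transform_frames J K eps xi2 f21 g1 g21 _ _ oJ oK He Y21 HG1)
      as (L21 & _ & C21 & E21).
    destruct (T_transform_frames J K eps xi1 f12 g2 g12 _ _ oJ oK He Y12 HG2)
      as (L12 & _ & C12 & E12).
    split; [exact L21 | split; [exact L12 | split; [| split]]].
    + intros s t Js Kt. rewrite E21, E12 by trivial. fold lam1 lam2.
      rewrite (darboux_frame_permutability _ _ lam1 lam2 1 f1 f2 f21 f12),
        (darboux_frame_permutability _ _ lam1 lam2 (-1) f1 f2 f21 f12); auto.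
    + intros s t Js Kt. rewrite C21 by trivial. now apply B21.
    + intros s t Js Kt. rewrite C12 by trivial. now apply B12.
  - destruct (T_transform_frames J K eps xi2 f21 g1 h21 _ _ oJ oK He X21 HG1)
      as (L21 & HG21 & C21 & _).
    destruct (LIEN_lax_frames J K h21 _ _ oJ oK L21 HG21) as (Sk21 & Lp & _).
    apply (KdV_ext J K (flow_bending h21)); trivial.
    + intros s t Js Kt. rewrite C21 by trivial. now apply B21.
    + now apply (lax_frame_KdV J K 1 (flow_bending h21)
        (darboux_frame (norm_p eps xi2) (cosh (2 * xi2)) 1 f21
           (darboux_frame (norm_p eps xi1) lam1 1 f1 Fp))).
Qed.
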